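(* Let $n>2$ be an integer, let $i,j\in\{1,\dots,n\}$, and let $q\in(-1,0)$ be the number such that $q+q^{-1}=-n$. Let $w=\sqrt{n+2}\,u_{ij}\in A_o(n)$, and let $\int$ denote the Haar functional of $A_o(n)$. Then for every integer $k\ge 0$ the even moments of $w$ are given by $$\int w^{2k}=\frac{q+1}{q-1}\cdot\frac{1}{k+1}\sum_{r=-k-1}^{k+1}(-1)^r\binom{2k+2}{k+1+r}\frac{r}{1+q^r},$$ and the odd moments are all zero: $\int w^{2k+1}=0$.
   Context: $A_o(n)$ is the universal unital $C^*$-algebra generated by $n^2$ self-adjoint elements $u_{ij}$ ($1\le i,j\le n$) subject to the relations $uu^t=u^tu=1$, where $u=(u_{ij})$ and $u^t=(u_{ji})$. It is a compact quantum group algebra in the sense of Woronowicz, with comultiplication $\Delta(u_{ij})=\sum_k u_{ik}\otimes u_{kj}$. The Haar functional, denoted $\int$, is the unique state on $A_o(n)$ that is left and right invariant: $(\mathrm{id}\otimes\int)\Delta(a)=(\int\otimes\,\mathrm{id})\Delta(a)=\left(\int a\right)1$ for all $a$. *)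

(* Defs.v *)
From HB Require Import structures.
From mathcomp Require Import all_boot all_order all_algebra.
From mathcomp Require Import all_classical all_reals all_analysis.
From mathcomp Require Import complex.

Set Implicit Arguments.
Unset Strict Implicit.
Unset Printing Implicit Defensive.

Import Order.TTheory GRing.Theory Num.Theory.
Import numFieldNormedType.Exports.

Local Open Scope ring_scope.
Local Open Scope complex_scope.
Local Open Scope classical_set_scope.

(* Unital C*-algebras over the complex numbers [R[i]]. The norm is a field of the
   structure, because the hierarchy admits no join of [GRing.Algebra] with the
   normed modules: their only join is [Num.NumDomain], which is commutative.
   [GRing.Algebra] imposes [1 != 0]; this excludes only the zero algebra. *)
HB.mixin Record hasCStar (R : realType) A of GRing.Algebra R[i] A := {
  star : A -> A;
  cstar_norm : A -> R;
  starK : involutive star;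
  starD : {morph star : a b / a + b};
  starZ : forall (c : R[i]) a, star (c *: a) = c^* *: star a;
  starM : forall a b, star (a * b) = star b * star a;
  cstar_normD : forall a b, cstar_norm (a + b) <= cstar_norm a + cstar_norm b;
  cstar_normZ : forall (c : R[i]) a,
    cstar_norm (c *: a) = ComplexField.Normc.normc c * cstar_norm a;
  cstar_norm0_eq0 : forall a, cstar_norm a = 0 -> a = 0;
  cstar_normM : forall a b, cstar_norm (a * b) <= cstar_norm a * cstar_norm b;
  cstar_norm_star : forall a, cstar_norm (star a * a) = cstar_norm a ^+ 2;
  cstar_complete : forall a : nat -> A,
    (forall e : R, 0 < e -> exists N : nat, forall k l : nat,
       (N <= k)%N -> (N <= l)%N -> cstar_norm (a k - a l) < e) ->
    exists x : A, cstar_norm (a k - x) @[k --> \oo] --> (0 : R) }.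

#[short(type="cstarAlgType")]
HB.structure Definition CStarAlgebra (R : realType) :=
  {A of GRing.Algebra R[i] A & hasCStar R A}.

Definition star_morphism (R : realType) (A B : cstarAlgType R)
    (f : {lrmorphism A -> B}) : Prop :=
  forall a, f (star a) = star (f a).

Definition state (R : realType) (A : cstarAlgType R)
    (phi : {scalar A}) : Prop :=
  (forall a, 0 <= phi (star a * a)) /\ phi 1 = 1.

Definition bounded_map (R : realType) (A B : cstarAlgType R)
    (E : {linear A -> B}) : Prop :=
  exists M : R, forall a, cstar_norm (E a) <= M * cstar_norm a.

Section FreeOrthogonal.
Variables (R : realType) (n : nat).

Definition orthogonal_relations (A : cstarAlgType R) (u : 'M[A]_n) : Prop :=
  [/\ forall i j, star (u i j) = u i j,
      u *m u^T = 1%:M & u^T *m u = 1%:M].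

(* [A], with the matrix of generators [u], is a model of A_o(n). Uniqueness of
   the induced morphism forces the [u i j] to generate [A] as a C*-algebra. *)
Record is_Ao (A : cstarAlgType R) (u : 'M[A]_n) : Prop := {
  Ao_relations : orthogonal_relations u;
  Ao_lift : forall (B : cstarAlgType R) (v : 'M[B]_n),
    orthogonal_relations v ->
    exists2 f : {lrmorphism A -> B},
      star_morphism f & forall i j, f (u i j) = v i j;
  Ao_unique : forall (B : cstarAlgType R) (f g : {lrmorphism A -> B}),
    star_morphism f -> star_morphism g ->
    (forall i j, f (u i j) = g (u i j)) -> f =1 g }.

End FreeOrthogonal.

Section TensorProduct.
Variables (R : realType) (A B : cstarAlgType R).

(* The image in [T] of the algebraic tensor [\sum_p p.1 (x) p.2]. *)
Definition tensor_sum (T : cstarAlgType R) (i1 : {lrmorphism A -> T})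
    (i2 : {lrmorphism B -> T}) (s : seq (A * B)) : T :=
  \sum_(p <- s) i1 p.1 * i2 p.2.

(* [T] is the completion of the algebraic tensor product of [A] and [B] for
   some C*-norm, with a (x) b = i1 a * i2 b. [tensor_inj] says that the
   canonical map from the algebraic tensor product to [T] is injective: a
   tensor \sum_k a_k (x) b_k with linearly independent a_k vanishes only if
   all the b_k do. *)
Record is_cstar_tensor (T : cstarAlgType R) (i1 : {lrmorphism A -> T})
    (i2 : {lrmorphism B -> T}) : Prop := {
  tensor_starl : star_morphism i1;
  tensor_starr : star_morphism i2;
  tensor_comm : forall a b, i1 a * i2 b = i2 b * i1 a;
  tensor_inj : forall m (a : 'I_m -> A) (b : 'I_m -> B),
    (forall c : 'I_m -> R[i],
       \sum_(k < m) c k *: a k = 0 -> forall k, c k = 0) ->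
    \sum_(k < m) i1 (a k) * i2 (b k) = 0 -> forall k, b k = 0;
  tensor_dense : forall (t : T) (e : R), 0 < e ->
    exists s, cstar_norm (t - tensor_sum i1 i2 s) < e }.

(* The minimal (spatial) C*-tensor product: by Takesaki's theorem the spatial
   norm is the smallest C*-norm on the algebraic tensor product. *)
Definition is_min_tensor (T : cstarAlgType R) (i1 : {lrmorphism A -> T})
    (i2 : {lrmorphism B -> T}) : Prop :=
  is_cstar_tensor i1 i2 /\
  forall (S : cstarAlgType R) (j1 : {lrmorphism A -> S})
    (j2 : {lrmorphism B -> S}),
    is_cstar_tensor j1 j2 ->
    forall s, cstar_norm (tensor_sum i1 i2 s) <= cstar_norm (tensor_sum j1 j2 s).

(* [E] is id (x) phi, the continuous extension of a (x) b |-> phi(b) a. *)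
Definition is_id_tensor (T : cstarAlgType R) (i1 : {lrmorphism A -> T})
    (i2 : {lrmorphism B -> T}) (phi : {scalar B}) (E : {linear T -> A}) : Prop :=
  bounded_map E /\ forall a b, E (i1 a * i2 b) = phi b *: a.

(* [E] is phi (x) id, the continuous extension of a (x) b |-> phi(a) b. *)
Definition is_tensor_id (T : cstarAlgType R) (i1 : {lrmorphism A -> T})
    (i2 : {lrmorphism B -> T}) (phi : {scalar A}) (E : {linear T -> B}) : Prop :=
  bounded_map E /\ forall a b, E (i1 a * i2 b) = phi a *: b.

End TensorProduct.

Section Haar.
Variables (R : realType) (A T : cstarAlgType R).
Variables (i1 i2 : {lrmorphism A -> T}).

Definition is_comultiplication n (u : 'M[A]_n)
    (Delta : {lrmorphism A -> T}) : Prop :=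
  star_morphism Delta /\
  forall i j, Delta (u i j) = \sum_(k < n) i1 (u i k) * i2 (u k j).

Record is_Haar (Delta : {lrmorphism A -> T}) (h : {scalar A}) : Prop := {
  Haar_state : state h;
  Haar_id_tensor : exists2 E : {linear T -> A},
    is_id_tensor i1 i2 h E & forall a, E (Delta a) = h a *: 1;
  Haar_tensor_id : exists2 E : {linear T -> A},
    is_tensor_id i1 i2 h E & forall a, E (Delta a) = h a *: 1 }.

End Haar.

(* \sum_(r = -N)^N F r, with r ranging over the integers. *)
Definition sum_symmetric (V : nmodType) (N : nat) (F : int -> V) : V :=
  \sum_(m < (2 * N).+1) F (m%:Z - N%:Z).

(* Main.v *)
(* For [n > 2], [A_o(n)] is shown to act on the Fock space
   [V = (+)_k H_k (x) H_k], where [H_k] is the range of the Jones-Wenzl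
   projection on the [k]-th tensor power of [C^n], by
     [u_ij = a_i^* (x) a_j^* + N a_i (x) a_j],  [N = [k]/[k+1]] in degree [k];
   the operators [a_i^*], [a_i] create and annihilate [e_i]. Let [P] be the
   matrix of vacuum expectations of the words in the [u_ij] and [H] the matrix
   of their Haar integrals. Invariance of the Haar state gives [P H = H], while
   equivariance of the Fock operators gives [P H = P]; hence [H = P].

   The vectors [x_k], the image of [e_i^k (x) e_j^k] in [H_k (x) H_k], satisfy
   [u_ij x_k = x_(k+1) + N_k c_k^2 x_(k-1)] with [c_(k+1) = 1 - N_k c_k]. After
   multiplication by [sqrt (n + 2)] these are the recurrence coefficients of the
   Rogers polynomials with parameters [beta = -q] and base [q], and expanding
   powers in Chebyshev polynomials gives the moments. *)
Require Import Defs.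
From HB Require Import structures.
From mathcomp Require Import all_boot all_order all_algebra.
From mathcomp Require Import all_classical all_reals all_analysis.
From mathcomp Require Import complex.
From mathcomp Require Import ring lra zify.

Set Implicit Arguments.
Unset Strict Implicit.
Unset Printing Implicit Defensive.

Import Order.TTheory GRing.Theory Num.Theory.
Import numFieldNormedType.Exports.

Local Open Scope ring_scope.
Local Open Scope complex_scope.

Local Notation Re := complex.Re.
Local Notation normc := ComplexField.Normc.normc.

(** * Pre-Hilbert spaces *)

(** The universal property of [A] produces morphisms only into complete algebras, whereas the Fock
    vectors used here have finite support. The target is therefore the algebra of bounded operator
    sequences modulo null ones; the Fock operators enter it as constant sequences, whose vacuum
    expectation depends only on the class.

    Invariance first gives an identity in [A] itself, [U H = H] with [U] a tensor power of [u]; the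
    universal morphism followed by the vacuum expectation replaces [U] by [P]. The other identity
    holds because the vacuum is fixed by the coaction and the Wenzl recursion involves only
    Kronecker deltas and contractions, which an orthogonal matrix respects.

    The constant [sqrt (n + 2)] is forced: [n + 2 = - (1 - q)^2 / q] cancels the factor
    [(1 - q)^(-2)] of [c_k^2]. The factor [r] and the binomials of order [2k + 2] in the final
    formula come from a summation by parts. *)

Record pre_hilbert (R : realType) := PreHilbert {
  ph_car :> lmodType R[i];
  form : ph_car -> ph_car -> R[i];
  formDl : forall x y z, form (x + y) z = form x z + form y z;
  formZl : forall c x y, form (c *: x) y = c * form x y;
  formC : forall x y, form y x = (form x y)^*;
  form_ge0 : forall x, 0 <= Re (form x x);
  form_nontrivial : exists x, 0 < Re (form x x) }.

Section PreHilbert.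
Variables (R : realType) (H : pre_hilbert R).
Implicit Types (x y z : H) (c : R[i]).

Definition nrm x : R := Num.sqrt (Re (form x x)).

Lemma formDr x y z : form x (y + z) = form x y + form x z.
Proof. by rewrite formC formDl rmorphD /= -!formC. Qed.

Lemma formZr c x y : form x (c *: y) = c^* * form x y.
Proof. by rewrite formC formZl rmorphM /= -formC. Qed.

Lemma form0l x : form 0 x = 0.
Proof. by rewrite -(scale0r 0) formZl mul0r. Qed.

Lemma formNl x y : form (- x) y = - form x y.
Proof. by rewrite -scaleN1r formZl mulN1r. Qed.

Lemma formNr x y : form x (- y) = - form x y.
Proof. by rewrite formC formNl rmorphN /= -formC. Qed.

Lemma ReD (a b : R[i]) : Re (a + b) = Re a + Re b.
Proof. by case: a b => [? ?] [? ?]. Qed.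

Lemma ReN (a : R[i]) : Re (- a) = - Re a.
Proof. by case: a. Qed.

Lemma nrm_ge0 x : 0 <= nrm x. Proof. exact: sqrtr_ge0. Qed.

Lemma sqr_nrm x : nrm x ^+ 2 = Re (form x x).
Proof. by rewrite sqr_sqrtr ?form_ge0. Qed.

Lemma Re_formC x y : Re (form x y) = Re (form y x).
Proof. by rewrite formC; case: (form y x). Qed.

Lemma Re_form_real (a : R) x y : Re (form (a%:C *: x) y) = a * Re (form x y).
Proof. by rewrite formZl; case: (form x y) => u v /=; rewrite mul0r subr0. Qed.

Lemma Re_form_realr (a : R) x y : Re (form x (a%:C *: y)) = a * Re (form x y).
Proof. by rewrite Re_formC Re_form_real Re_formC. Qed.

Lemma form_cauchy_schwarz x y : Re (form x y) <= nrm x * nrm y.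
Proof.
have quad (a b : R) : 0 <= a ^+ 2 * nrm x ^+ 2 - 2 * a * b * Re (form x y)
    + b ^+ 2 * nrm y ^+ 2.
  have := form_ge0 (a%:C *: x - b%:C *: y).
  rewrite formDl !formDr !formNl !formNr !ReD !ReN.
  rewrite !Re_form_real !Re_form_realr (Re_formC y x) -!sqr_nrm.
  by congr (_ <= _); ring.
have [x0|xn0] := eqVneq (nrm x) 0.
  (* With [nrm x = 0] this choice makes the quadratic expression equal to minus the square of the
     real part times [nrm y ^+ 2 + 2], so the real part is zero. *)
  have := quad (nrm y ^+ 2 + 1) (Re (form x y)); rewrite x0 expr0n mulr0 /=.
  have := sqr_ge0 (Re (form x y)); have := sqr_ge0 (nrm y).
  by move: (Re _) (nrm y) => u v; nra.
have [y0|yn0] := eqVneq (nrm y) 0.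
  have := quad (Re (form x y)) (nrm x ^+ 2 + 1); rewrite y0 expr0n mulr0 /=.
  have := sqr_ge0 (Re (form x y)); have := sqr_ge0 (nrm x).
  by move: (Re _) (nrm x) => u v; nra.
have p : 0 < nrm x * nrm y by rewrite mulr_gt0 ?lt0r ?xn0 ?yn0 ?nrm_ge0.
have := quad (nrm y) (nrm x).
rewrite (_ : _ + _ = 2 * (nrm x * nrm y) * (nrm x * nrm y - Re (form x y))).
  by rewrite pmulr_rge0 ?subr_ge0 // mulr_gt0.
ring.
Qed.

Lemma nrmD x y : nrm (x + y) <= nrm x + nrm y.
Proof.
rewrite -ler_sqr ?nnegrE ?addr_ge0 ?nrm_ge0 // sqr_nrm formDl !formDr !ReD.
rewrite (Re_formC y x) -!sqr_nrm.
have := form_cauchy_schwarz x y; move: (Re _) (nrm x) (nrm y) => a b c; lra.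
Qed.

Lemma nrmZ c x : nrm (c *: x) = normc c * nrm x.
Proof.
rewrite /nrm formZl formZr mulrA; case: c => a b /=.
rewrite -sqrtrM ?addr_ge0 ?sqr_ge0 //; congr Num.sqrt.
by case: (form x x) => u v /=; ring.
Qed.

Lemma normcN1 : normc (-1 : R[i]) = 1.
Proof. by rewrite /= oppr0 expr0n addr0 sqrrN expr1n sqrtr1. Qed.

Lemma nrmN x : nrm (- x) = nrm x.
Proof. by rewrite -scaleN1r nrmZ normcN1 mul1r. Qed.

Lemma nrm0 : nrm 0 = 0.
Proof. by rewrite /nrm form0l sqrtr0. Qed.

(** The form is only semidefinite, so vectors are compared through their pairings instead of by
    equality. *)
Lemma nrm_eq x y : (forall z, form x z = form y z) -> nrm x = nrm y.
Proof. by move=> e; rewrite /nrm e formC e -formC. Qed.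

End PreHilbert.

(** * Bounded operators modulo null sequences *)

Section OpSeq.
Variables (R : realType) (H : pre_hilbert R).
Implicit Types (x y z : H) (c : R[i]) (C : R) (T : nat -> H -> H).

(** A bound from some index on: the infimum of such [C] is the limsup of the operator norms, and a
    null sequence is one that admits every [C > 0]. *)
Definition bnd C T : Prop := 0 <= C /\
  exists N, forall k x, (N <= k)%N -> nrm (T k x) <= C * nrm x.

Lemma bnd_le C C' T : C <= C' -> bnd C T -> bnd C' T.
Proof.
move=> le [C0 [N bN]]; split; first exact: le_trans le.
by exists N => k x /bN /le_trans; apply; rewrite ler_wpM2r ?nrm_ge0.
Qed.

Lemma bndD C C' T S : bnd C T -> bnd C' S -> bnd (C + C') (fun k x => T k x + S k x).
Proof.
move=> [C0 [N bN]] [C0' [N' bN']]; split; first exact: addr_ge0.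
exists (maxn N N') => k x; rewrite geq_max => /andP[/bN bk /bN' bk'].
by rewrite (le_trans (nrmD _ _)) // mulrDl lerD.
Qed.

Lemma bnd_comp C C' T S : bnd C T -> bnd C' S -> bnd (C * C') (fun k x => T k (S k x)).
Proof.
move=> [C0 [N bN]] [C0' [N' bN']]; split; first exact: mulr_ge0.
exists (maxn N N') => k x; rewrite geq_max => /andP[/bN bk /bN' bk'].
by rewrite (le_trans (bk _)) // -mulrA ler_wpM2l.
Qed.

Lemma bndZ C c T : bnd C T -> bnd (normc c * C) (fun k x => c *: T k x).
Proof.
have c0 : 0 <= normc c by case: c => a b; exact: sqrtr_ge0.
move=> [C0 [N bN]]; split; first exact: mulr_ge0.
by exists N => k x /bN ?; rewrite nrmZ -mulrA ler_wpM2l.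
Qed.

Lemma bnd_nrm_eq C T S : (forall k x, nrm (T k x) = nrm (S k x)) -> bnd C T -> bnd C S.
Proof. by move=> e [C0 [N bN]]; split=> //; exists N => k x; rewrite -e; apply: bN. Qed.

(* Only boundedness is required, not convergence: bounded sequences modulo null
   ones already form a complete algebra, so [H] need not be completed. The
   boundedness of [adj] and the linearity of [op] up to null vectors follow from
   [opP]. *)
Record opseq := OpSeq {
  op : nat -> H -> H;
  adj : nat -> H -> H;
  opP : forall k x y, form (op k x) y = form x (adj k y);
  op_bounded : exists C, bnd C op }.

Implicit Types (s t : opseq).

Lemma form_opr s k x y : form x (op s k y) = form (adj s k x) y.
Proof. by rewrite formC opP -formC. Qed.

Lemma form_adj s k x y : form (adj s k x) y = form x (op s k y).
Proof. by rewrite form_opr. Qed.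

(** [|T'x|^2 = <T T'x, x> <= C |T'x| |x|], and one factor [|T'x|] cancels. *)
Lemma bnd_adjoint C T T' : (forall k x y, form (T k x) y = form x (T' k y)) ->
  bnd C T -> bnd C T'.
Proof.
move=> TP [C0 [N bN]]; split=> //; exists N => k x lek.
have [->|nz] := eqVneq (nrm (T' k x)) 0; first by rewrite mulr_ge0 ?nrm_ge0.
have p : 0 < nrm (T' k x) by rewrite lt0r nz nrm_ge0.
rewrite -(ler_pM2l p) -expr2 sqr_nrm -TP.
rewrite (le_trans (form_cauchy_schwarz _ _)) // mulrA.
by rewrite ler_wpM2r ?nrm_ge0 // [leRHS]mulrC bN.
Qed.

Definition opseq_sim s t : Prop :=
  forall e, 0 < e -> bnd e (fun k x => op s k x - op t k x).

Lemma opseq_sim_form s t :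
  (forall k x y, form (op s k x) y = form (op t k x) y) -> opseq_sim s t.
Proof.
move=> st e e0; split; first exact: ltW.
exists 0%N => k x _; rewrite (@nrm_eq _ _ _ 0) ?nrm0 ?mulr_ge0 ?nrm_ge0 ?ltW // => z.
by rewrite formDl formNl st subrr form0l.
Qed.

Lemma opseq_sim_sym s t : opseq_sim s t -> opseq_sim t s.
Proof.
by move=> st e /st; apply: bnd_nrm_eq => k x; rewrite -nrmN opprB.
Qed.

Lemma opseq_sim_trans s t r : opseq_sim s t -> opseq_sim t r -> opseq_sim s r.
Proof.
move=> st tr e e0; have e20 : 0 < e / 2 by rewrite divr_gt0.
rewrite (splitr e); apply: bnd_nrm_eq (bndD (st _ e20) (tr _ e20)) => k x.
by rewrite addrA subrK.
Qed.

Definition opseq_rel : rel opseq := fun s t => `[< opseq_sim s t >].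

Lemma opseq_rel_equiv : equiv_class_of opseq_rel.
Proof.
split.
- by move=> s; apply/asboolP/opseq_sim_form.
- by move=> s t; apply/asboolP/asboolP; exact: opseq_sim_sym.
- move=> s t r /asboolP h1 /asboolP h2; apply/asboolP; exact: opseq_sim_trans h2.
Qed.

Definition opseq_add s t : opseq.
Proof.
exists (fun k x => op s k x + op t k x) (fun k x => adj s k x + adj t k x).
- by move=> k x y; rewrite formDl !opP formDr.
- have [[C bC] [D bD]] := (op_bounded s, op_bounded t).
  by exists (C + D); exact: bndD.
Defined.

Definition opseq_mul s t : opseq.
Proof.
exists (fun k x => op s k (op t k x)) (fun k x => adj t k (adj s k x)).
- by move=> k x y; rewrite !opP.
- have [[C bC] [D bD]] := (op_bounded s, op_bounded t).
  by exists (C * D); exact: bnd_comp.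
Defined.

Definition opseq_scale c s : opseq.
Proof.
exists (fun k x => c *: op s k x) (fun k x => c^* *: adj s k x).
- by move=> k x y; rewrite formZl formZr conjCK opP.
- have [C bC] := op_bounded s.
  by exists (normc c * C); exact: bndZ.
Defined.

Definition opseq_star s : opseq.
Proof.
exists (adj s) (op s).
- by move=> k x y; rewrite form_adj.
- have [C bC] := op_bounded s.
  by exists C; exact: (bnd_adjoint (opP s)).
Defined.

Definition opseq_const (T T' : H -> H)
  (TP : forall x y, form (T x) y = form x (T' y))
  (bT : exists C, 0 <= C /\ forall x, nrm (T x) <= C * nrm x) : opseq.
Proof.
exists (fun=> T) (fun=> T'); first by move=> _.
by have [C [C0 bC]] := bT; exists C; split=> //; exists 0%N.
Defined.

Lemma id_bounded : exists C, 0 <= C /\ forall x, nrm (id x) <= C * nrm x.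
Proof. by exists 1; split=> // x; rewrite mul1r. Qed.

Definition opseq_one := @opseq_const id id (fun _ _ => erefl) id_bounded.

Lemma form_zero x y : form (0 : H) y = form x (0 : H).
Proof. by rewrite [RHS]formC !form0l conjc0. Qed.

Lemma zero_bounded : exists C, 0 <= C /\ forall x, nrm (0 : H) <= C * nrm x.
Proof. by exists 0; split=> // x; rewrite mul0r nrm0. Qed.

Definition opseq_zero := @opseq_const (fun=> 0) (fun=> 0) form_zero zero_bounded.

Lemma opseq_add_sim s s' t t' : opseq_sim s s' -> opseq_sim t t' ->
  opseq_sim (opseq_add s t) (opseq_add s' t').
Proof.
move=> ss tt e e0; have e20 : 0 < e / 2 by rewrite divr_gt0.
rewrite (splitr e); apply: bnd_nrm_eq (bndD (ss _ e20) (tt _ e20)) => k x.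
by rewrite /= opprD addrACA.
Qed.

Lemma opseq_scale_sim c s s' : opseq_sim s s' ->
  opseq_sim (opseq_scale c s) (opseq_scale c s').
Proof.
move=> ss e e0.
have c0 : 0 <= normc c by case: (c) => a b; exact: sqrtr_ge0.
have c1 : 0 < normc c + 1 by rewrite ltr_wpDl.
have := bndZ c (ss _ (divr_gt0 e0 c1)).
move=> /(bnd_nrm_eq (S := fun k x => c *: op s k x - c *: op s' k x)) b.
apply: bnd_le (b _) => [|k x]; last by rewrite scalerBr.
by rewrite mulrA ler_pdivrMr // mulrC ler_pM2l // lerDl.
Qed.

Lemma opseq_star_sim s s' : opseq_sim s s' -> opseq_sim (opseq_star s) (opseq_star s').
Proof.
move=> ss e e0; apply: bnd_adjoint (ss _ e0) => k x y /=.
by rewrite formDl formNl !opP formDr formNr.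
Qed.

Lemma opseq_mul_sim s s' t t' : opseq_sim s s' -> opseq_sim t t' ->
  opseq_sim (opseq_mul s t) (opseq_mul s' t').
Proof.
move=> ss tt e e0.
have [C bC] := op_bounded t; have [D bD] := op_bounded s'.
have p T B : bnd B T -> 0 < B + 1 by case=> ? _; rewrite ltr_wpDl.
have e20 : 0 < e / 2 by rewrite divr_gt0.
have b1 := bnd_comp (ss _ (divr_gt0 e20 (p _ _ bC))) bC.
have b2 := bnd_comp bD (tt _ (divr_gt0 e20 (p _ _ bD))).
have small B : 0 < B + 1 -> e / 2 / (B + 1) * B <= e / 2.
  by move=> B0; rewrite mulrAC ler_pdivrMr // ler_pM2l // lerDl.
rewrite (mulrC D) in b2.
have := bndD (bnd_le (small _ (p _ _ bC)) b1) (bnd_le (small _ (p _ _ bD)) b2).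
(* The splitting [(s - s') t + s' (t - t')] is checked against the form, since [op s' k] is additive
   only up to null vectors. *)
rewrite -splitr; apply: bnd_nrm_eq => k x; apply: nrm_eq => z /=.
by rewrite !(formDl, formNl, opP) addrA subrK.
Qed.

End OpSeq.

HB.instance Definition _ (R : realType) (H : pre_hilbert R) :=
  gen_eqMixin (opseq H).
HB.instance Definition _ (R : realType) (H : pre_hilbert R) :=
  gen_choiceMixin (opseq H).

(** * The algebra of operator sequences modulo null sequences *)

Section OpAlgebra.
Variables (R : realType) (H : pre_hilbert R).

Canonical opseq_equiv := EquivRelPack (opseq_rel_equiv H).

Definition opalg := {eq_quot opseq_equiv}%qT.
HB.instance Definition _ := Choice.on opalg.

Definition cls (s : opseq H) : opalg := (\pi_({eq_quot opseq_equiv}) s)%qT.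

Lemma clsP s t : cls s = cls t <-> opseq_sim s t.
Proof.
rewrite /cls; split; first by move/eqmodP/asboolP.
by move=> st; apply/eqmodP/asboolP.
Qed.

Lemma cls_repr (a : opalg) : cls (repr a) = a.
Proof. exact: reprK. Qed.

Lemma opalgP (a : opalg) : exists s, a = cls s.
Proof. by exists (repr a); rewrite cls_repr. Qed.

Lemma repr_cls s : opseq_sim (repr (cls s)) s.
Proof. by apply/clsP; rewrite cls_repr. Qed.

Lemma cls_form s t :
  (forall k x y, form (op s k x) y = form (op t k x) y) -> cls s = cls t.
Proof. by move=> e; apply/clsP/opseq_sim_form. Qed.

Definition opalg_add (a b : opalg) := cls (opseq_add (repr a) (repr b)).
Definition opalg_mul (a b : opalg) := cls (opseq_mul (repr a) (repr b)).
Definition opalg_scale (c : R[i]) (a : opalg) := cls (opseq_scale c (repr a)).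
Definition opalg_star (a : opalg) := cls (opseq_star (repr a)).

Lemma cls_add s t : opalg_add (cls s) (cls t) = cls (opseq_add s t).
Proof. by apply/clsP/opseq_add_sim; exact: repr_cls. Qed.

Lemma cls_mul s t : opalg_mul (cls s) (cls t) = cls (opseq_mul s t).
Proof. by apply/clsP/opseq_mul_sim; exact: repr_cls. Qed.

Lemma cls_scale c s : opalg_scale c (cls s) = cls (opseq_scale c s).
Proof. by apply/clsP/opseq_scale_sim; exact: repr_cls. Qed.

Lemma cls_star s : opalg_star (cls s) = cls (opseq_star s).
Proof. by apply/clsP/opseq_star_sim; exact: repr_cls. Qed.

Definition clsE := (cls_add, cls_mul, cls_scale, cls_star).

Let opalg0 := cls (opseq_zero H).
Let opalg1 := cls (opseq_one H).
Let opalg_opp := opalg_scale (-1).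

Lemma opalg_addA : associative opalg_add.
Proof.
move=> a b c; have [[s ->] [t ->]] := (opalgP a, opalgP b).
have [r ->] := opalgP c; rewrite !clsE; apply: cls_form => k x y /=.
by rewrite addrA.
Qed.

Lemma opalg_addC : commutative opalg_add.
Proof.
move=> a b; have [[s ->] [t ->]] := (opalgP a, opalgP b).
by rewrite !clsE; apply: cls_form => k x y /=; rewrite addrC.
Qed.

Lemma opalg_add0 : left_id opalg0 opalg_add.
Proof.
move=> a; have [s ->] := opalgP a.
by rewrite !clsE; apply: cls_form => k x y /=; rewrite add0r.
Qed.

Lemma opalg_addN : left_inverse opalg0 opalg_opp opalg_add.
Proof.
move=> a; have [s ->] := opalgP a; rewrite /opalg_opp !clsE.
by apply: cls_form => k x y /=; rewrite scaleN1r addNr.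
Qed.

HB.instance Definition _ := GRing.isZmodule.Build opalg
  opalg_addA opalg_addC opalg_add0 opalg_addN.

Lemma opalg_mulA : associative opalg_mul.
Proof.
move=> a b c; have [[s ->] [t ->]] := (opalgP a, opalgP b).
by have [r ->] := opalgP c; rewrite !clsE; apply: cls_form.
Qed.

Lemma opalg_mul1l : left_id opalg1 opalg_mul.
Proof.
by move=> a; have [s ->] := opalgP a; rewrite !clsE; apply: cls_form.
Qed.

Lemma opalg_mul1r : right_id opalg1 opalg_mul.
Proof.
by move=> a; have [s ->] := opalgP a; rewrite !clsE; apply: cls_form.
Qed.

Lemma opalg_mulDl : left_distributive opalg_mul opalg_add.
Proof.
move=> a b c; have [[s ->] [t ->]] := (opalgP a, opalgP b).
by have [r ->] := opalgP c; rewrite !clsE; apply: cls_form.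
Qed.

Lemma opalg_mulDr : right_distributive opalg_mul opalg_add.
Proof.
move=> a b c; have [[s ->] [t ->]] := (opalgP a, opalgP b).
have [r ->] := opalgP c; rewrite !clsE; apply: cls_form => k x y /=.
by rewrite !(formDl, opP).
Qed.

Lemma opalg1_neq0 : opalg1 != opalg0.
Proof.
apply/eqP => /clsP sim; have [x x0] := form_nontrivial H.
have h0 : 0 < 1 / 2 :> R by lra.
have [_ [N]] := sim _ h0; move=> /(_ N x (leqnn N)) /=; rewrite subr0.
have : 0 < nrm x by rewrite sqrtr_gt0.
by move: (nrm x) => ?; lra.
Qed.

HB.instance Definition _ := GRing.Zmodule_isNzRing.Build opalg
  opalg_mulA opalg_mul1l opalg_mul1r opalg_mulDl opalg_mulDr opalg1_neq0.

Lemma opalg_scaleA c d (a : opalg) :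
  opalg_scale c (opalg_scale d a) = opalg_scale (c * d) a.
Proof.
have [s ->] := opalgP a.
by rewrite !clsE; apply: cls_form => k x y /=; rewrite scalerA.
Qed.

Lemma opalg_scale1 : left_id 1 opalg_scale.
Proof.
move=> a; have [s ->] := opalgP a.
by rewrite !clsE; apply: cls_form => k x y /=; rewrite scale1r.
Qed.

Lemma opalg_scaleDr : right_distributive opalg_scale +%R.
Proof.
move=> c a b; have [[s ->] [t ->]] := (opalgP a, opalgP b).
rewrite /GRing.add /= !clsE.
by apply: cls_form => k x y /=; rewrite scalerDr.
Qed.

Lemma opalg_scaleDl (a : opalg) : {morph opalg_scale^~ a : c d / c + d}.
Proof.
move=> c d; have [s ->] := opalgP a; rewrite /GRing.add /= !clsE.
by apply: cls_form => k x y /=; rewrite scalerDl.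
Qed.

HB.instance Definition _ := GRing.Zmodule_isLmodule.Build R[i] opalg
  opalg_scaleA opalg_scale1 opalg_scaleDr opalg_scaleDl.

Lemma opalg_scaleAl c (a b : opalg) : c *: (a * b) = c *: a * b.
Proof.
have [[s ->] [t ->]] := (opalgP a, opalgP b).
rewrite /GRing.mul /GRing.scale /= !clsE.
exact: cls_form.
Qed.

HB.instance Definition _ := GRing.Lmodule_isLalgebra.Build R[i] opalg opalg_scaleAl.

Lemma opalg_scaleAr c (a b : opalg) : c *: (a * b) = a * (c *: b).
Proof.
have [[s ->] [t ->]] := (opalgP a, opalgP b).
rewrite /GRing.mul /GRing.scale /= !clsE; apply: cls_form => k x y /=.
by rewrite formZl opP [RHS]opP formZl opP.
Qed.

HB.instance Definition _ := GRing.Lalgebra_isAlgebra.Build R[i] opalg opalg_scaleAr.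

End OpAlgebra.

(** * Its C*-norm and its completeness *)

Section OpAlgebraNorm.
Variables (R : realType) (H : pre_hilbert R).
Implicit Types (s t : opseq H) (a b : opalg H).

Local Open Scope classical_set_scope.

Lemma clsD s t : cls s + cls t = cls (opseq_add s t). Proof. exact: cls_add. Qed.
Lemma clsM s t : cls s * cls t = cls (opseq_mul s t). Proof. exact: cls_mul. Qed.
Lemma clsZ (c : R[i]) s : c *: cls s = cls (opseq_scale c s).
Proof. exact: cls_scale. Qed.

Definition opalg_bnd (C : R) a : Prop := bnd C (op (repr a)).

Definition opalg_norm a : R := inf [set C | opalg_bnd C a].

Lemma bnd_ge0 C (T : nat -> H -> H) : bnd C T -> 0 <= C. Proof. by case. Qed.

Lemma opalg_norm_le C a : opalg_bnd C a -> opalg_norm a <= C.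
Proof. by move=> bC; apply: ge_inf => //; exists 0 => D /bnd_ge0. Qed.

Lemma opalg_norm_ge0 a : 0 <= opalg_norm a.
Proof.
apply: lb_le_inf => [|C /bnd_ge0 //].
exact: op_bounded.
Qed.

Lemma opalg_norm_bnd C a : opalg_norm a < C -> opalg_bnd C a.
Proof.
move=> lt; have [||D bD DC] := @inf_adherent _ [set C | opalg_bnd C a] (C - opalg_norm a).
- by rewrite subr_gt0.
- by split; [exact: op_bounded|exists 0 => D /bnd_ge0].
- by apply: bnd_le bD; rewrite ltW // (lt_le_trans DC) // addrC subrK.
Qed.

Lemma opalg_norm_leP C a :
  opalg_norm a <= C <-> forall e, 0 < e -> opalg_bnd (C + e) a.
Proof.
split=> [le e e0|h]; first by apply: opalg_norm_bnd; rewrite ltr_pwDr.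
by apply/ler_addgt0Pr => e e0; apply: opalg_norm_le; exact: h.
Qed.

Lemma bnd_sim C s t : opseq_sim s t -> bnd C (op s) ->
  forall e, 0 < e -> bnd (C + e) (op t).
Proof.
move=> st bC e /st be.
have be' : bnd e (fun k x => op t k x - op s k x).
  by apply: bnd_nrm_eq be => k x; rewrite -nrmN opprB.
by apply: bnd_nrm_eq (bndD bC be') => k x; rewrite addrC subrK.
Qed.

(** The infimum need not be attained, and a change of representative costs an arbitrarily small
    amount. The slack [e] absorbs both, so any representative may be tested. *)
Lemma cls_norm_leP C s :
  opalg_norm (cls s) <= C <-> forall e, 0 < e -> bnd (C + e) (op s).
Proof.
rewrite opalg_norm_leP; split=> h e e0; have e20 : 0 < e / 2 by rewrite divr_gt0.
  rewrite (splitr e) addrA.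
  exact: (bnd_sim (repr_cls s) (h _ e20)).
rewrite (splitr e) addrA.
exact: (bnd_sim (opseq_sim_sym (repr_cls s)) (h _ e20)).
Qed.

Lemma cls_norm_bnd s e : 0 < e -> bnd (opalg_norm (cls s) + e) (op s).
Proof. by move: e; apply/cls_norm_leP. Qed.

Lemma cls_norm_le C s : bnd C (op s) -> opalg_norm (cls s) <= C.
Proof. by move=> bC; apply/cls_norm_leP => e e0; apply: bnd_le bC; rewrite lerDl ltW. Qed.

Lemma opalg_starK : involutive (@opalg_star _ H).
Proof. by move=> a; have [s ->] := opalgP a; rewrite !clsE; apply: cls_form. Qed.

Lemma opalg_starD : {morph @opalg_star _ H : a b / a + b}.
Proof.
move=> a b; have [[s ->] [t ->]] := (opalgP a, opalgP b).
by rewrite clsD !clsE clsD; apply: cls_form.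
Qed.

Lemma opalg_starZ (c : R[i]) a : opalg_star (c *: a) = c^* *: opalg_star a.
Proof.
by have [s ->] := opalgP a; rewrite clsZ !clsE clsZ; apply: cls_form.
Qed.

Lemma opalg_starM a b : opalg_star (a * b) = opalg_star b * opalg_star a.
Proof.
have [[s ->] [t ->]] := (opalgP a, opalgP b).
by rewrite clsM !clsE clsM; apply: cls_form.
Qed.

Lemma opalg_normD a b : opalg_norm (a + b) <= opalg_norm a + opalg_norm b.
Proof.
have [[s ->] [t ->]] := (opalgP a, opalgP b); rewrite clsD.
apply/cls_norm_leP => e e0; have e20 : 0 < e / 2 by rewrite divr_gt0.
by rewrite (splitr e) addrACA; apply: bndD; apply: cls_norm_bnd.
Qed.

Lemma opalg_normZ_le (c : R[i]) a : opalg_norm (c *: a) <= normc c * opalg_norm a.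
Proof.
have c0 : 0 <= normc c by case: (c) => u v; exact: sqrtr_ge0.
have c1 : 0 < normc c + 1 by rewrite ltr_wpDl.
have [s ->] := opalgP a; rewrite clsZ; apply/cls_norm_leP => e e0.
apply: bnd_le (bndZ c (cls_norm_bnd s (divr_gt0 e0 c1))).
by rewrite mulrDr lerD2l mulrA ler_pdivrMr // mulrC ler_pM2l // lerDl.
Qed.

Lemma opalg_normZ (c : R[i]) a : opalg_norm (c *: a) = normc c * opalg_norm a.
Proof.
apply/eqP; rewrite eq_le opalg_normZ_le /=.
have [->|c0] := eqVneq c 0.
  by rewrite /= expr0n addr0 sqrtr0 mul0r opalg_norm_ge0.
have p : 0 < normc c.
  rewrite lt0r; case: (c) c0 => u v; rewrite sqrtr_ge0 andbT.
  by apply: contra => /eqP/ComplexField.Normc.eq0_normc ->.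
rewrite -ler_pdivlMl // -ComplexField.Normc.normcV.
by rewrite (le_trans _ (opalg_normZ_le _ _)) // scalerA mulVf // scale1r.
Qed.

Lemma opalg_norm0_eq0 a : opalg_norm a = 0 -> a = 0.
Proof.
have [s ->] := opalgP a => s0; apply/clsP => e e0.
have : forall e, 0 < e -> bnd (0 + e) (op s) by apply/cls_norm_leP; rewrite s0.
by move=> /(_ e e0); rewrite add0r; apply: bnd_nrm_eq => k x /=; rewrite subr0.
Qed.

Lemma opalg_normM a b : opalg_norm (a * b) <= opalg_norm a * opalg_norm b.
Proof.
have [[s ->] [t ->]] := (opalgP a, opalgP b); rewrite clsM.
apply/ler_addgt0Pr => e e0.
set A := opalg_norm (cls s); set B := opalg_norm (cls t).
have A0 : 0 <= A by exact: opalg_norm_ge0.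
have B0 : 0 <= B by exact: opalg_norm_ge0.
have K0 : 0 < A + B + 1 by rewrite ltr_wpDl ?addr_ge0.
pose d := Num.min 1 (e / (A + B + 1)).
have d0 : 0 < d by rewrite lt_min ltr01 divr_gt0.
have d1 : d <= 1 by rewrite ge_min lexx.
have dK : d * (A + B + 1) <= e by rewrite -ler_pdivlMr // ge_min lexx orbT.
apply: cls_norm_le; apply: bnd_le (bnd_comp (cls_norm_bnd s d0) (cls_norm_bnd t d0)).
rewrite -/A -/B; have : d * d <= d by rewrite ler_piMr // ltW.
move: dK; clearbody A B d => dK dd; nra.
Qed.

Lemma opalg_norm_star_le a : opalg_norm (opalg_star a) <= opalg_norm a.
Proof.
have [s ->] := opalgP a; rewrite !clsE; apply/cls_norm_leP => e e0.
exact: bnd_adjoint (opP s) (cls_norm_bnd s e0).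
Qed.

Lemma opalg_norm_cstar a : opalg_norm (opalg_star a * a) = opalg_norm a ^+ 2.
Proof.
apply/eqP; rewrite eq_le; apply/andP; split.
  rewrite (le_trans (opalg_normM _ _)) // expr2 ler_wpM2r ?opalg_norm_ge0 //.
  exact: opalg_norm_star_le.
(* Conversely [|s x|^2 = <x, s^* s x> <= |s^* s| |x|^2]; the bound for [s] is a square root. *)
have [s ->] := opalgP a; rewrite clsE clsM.
set B := opalg_norm (cls (opseq_mul _ _)).
have B0 : 0 <= B by exact: opalg_norm_ge0.
apply/ler_addgt0Pr => e e0; have Be0 : 0 <= B + e by rewrite addr_ge0 // ltW.
rewrite -[leRHS]sqr_sqrtr // ler_sqr ?nnegrE ?sqrtr_ge0 ?opalg_norm_ge0 //.
apply: cls_norm_le; split; first exact: sqrtr_ge0.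
have [_ [N bN]] := cls_norm_bnd (opseq_mul (opseq_star s) s) e0.
exists N => k x /(bN k x) /= le.
rewrite -ler_sqr ?nnegrE ?mulr_ge0 ?nrm_ge0 ?sqrtr_ge0 //.
rewrite exprMn [leLHS]sqr_nrm sqr_sqrtr // opP (le_trans (form_cauchy_schwarz _ _)) //.
by rewrite [_ ^+ 2]expr2 mulrA mulrC ler_wpM2r ?nrm_ge0.
Qed.

Lemma clsB s t : cls s - cls t = cls (opseq_add s (opseq_scale (-1) t)).
Proof. by rewrite -scaleN1r clsZ clsD. Qed.

Lemma cls_normB_lt C s t : opalg_norm (cls s - cls t) < C ->
  bnd C (fun k x => op s k x - op t k x).
Proof.
rewrite clsB -subr_gt0 => /(cls_norm_bnd (opseq_add s (opseq_scale (-1) t))).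
rewrite addrCA subrr addr0.
by apply: bnd_nrm_eq => k x /=; rewrite scaleN1r.
Qed.

Lemma cls_normB_le C s t : bnd C (fun k x => op s k x - op t k x) ->
  opalg_norm (cls s - cls t) <= C.
Proof.
move=> b; rewrite clsB; apply: cls_norm_le.
by apply: bnd_nrm_eq b => k x /=; rewrite scaleN1r.
Qed.

(* The limit of a fast Cauchy sequence of classes is represented by a diagonal
   sequence: at index [m] use the last representative whose distances to its
   predecessors are already controlled from [m] on. *)
Lemma opalg_fast_complete (s : nat -> opseq H) (eps : nat -> R) :
  (forall j l, (j <= l)%N -> bnd (eps j) (fun m x => op (s j) m x - op (s l) m x)) ->
  exists t, forall j, bnd (eps j) (fun m x => op (s j) m x - op t m x).
Proof.
move=> bs.
pose good m l := [forall j : 'I_l.+1, forall l' : 'I_l.+1, (j <= l')%N ==>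
  `[< forall m' x, (m <= m')%N ->
      nrm (op (s j) m' x - op (s l') m' x) <= eps j * nrm x >]].
pose L m : nat := \max_(l < m.+1 | good m l) l.
have good0 m : good m 0%N.
  apply/forallP => j; apply/forallP => l'; apply/implyP => _; apply/asboolP => m' x _.
  rewrite (ord1 j) (ord1 l') subrr nrm0 mulr_ge0 ?nrm_ge0 //.
  by have [] := bs 0%N 0%N (leqnn 0).
have goodL m : good m (L m).
  rewrite /L; have [|l gl ->] := @eq_bigmax_cond _ [pred l : 'I_m.+1 | good m l]
    (fun l => l : nat).
    by apply/card_gt0P; exists ord0; rewrite inE; exact: good0.
  by rewrite inE in gl.
(* [L] tends to infinity: [good m l] consists of finitely many conditions, each true for large
   [m]. *)
have large l : exists M, forall m, (M <= m)%N -> (l <= L m)%N.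
  have /choice [N bN] : forall p : nat * nat, exists N, (p.1 <= p.2)%N ->
      forall m x, (N <= m)%N ->
        nrm (op (s p.1) m x - op (s p.2) m x) <= eps p.1 * nrm x.
    move=> [j l'] /=; have [le|] := leqP j l'; last by exists 0%N.
    by have [_ [N bN]] := bs _ _ le; exists N => _ m x; exact: bN.
  exists (maxn l (\max_(j < l.+1) \max_(l' < l.+1) N (j : nat, l' : nat))) => m.
  rewrite geq_max => /andP[lm bm].
  have lm1 : (l < m.+1)%N by [].
  apply: (@leq_bigmax_cond _ (fun l : 'I_m.+1 => good m l)
    (fun l => l : nat) (Ordinal lm1)) => /=.
  apply/forallP => j; apply/forallP => l'; apply/implyP => jl.
  apply/asboolP => m' x mm'; apply: (bN (j : nat, l' : nat)) => //.
  apply: leq_trans mm'; apply: leq_trans bm.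
  apply: leq_trans (leq_bigmax_cond (F := fun j : 'I_l.+1 =>
    \max_(l' < l.+1) N (j : nat, l' : nat)) j isT).
  exact: (leq_bigmax_cond (F := fun l' : 'I_l.+1 => N (j : nat, l' : nat)) l' isT).
have near j : bnd (eps j) (fun m x => op (s j) m x - op (s (L m)) m x).
  have [e0 _] := bs j j (leqnn j); split=> //.
  have [M bM] := large j; exists M => m x /bM jL.
  have /forallP/(_ (Ordinal (jL : (j < (L m).+1)%N)))/forallP := goodL m.
  by move=> /(_ ord_max)/implyP/(_ jL)/asboolP/(_ m x (leqnn m)).
have bt : exists C, bnd C (fun m => op (s (L m)) m).
  have [C bC] := op_bounded (s 0%N); exists (C + eps 0%N).
  have b0 : bnd (eps 0%N) (fun m x => op (s (L m)) m x - op (s 0%N) m x).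
    by apply: bnd_nrm_eq (near 0%N) => k x; rewrite -nrmN opprB.
  by apply: bnd_nrm_eq (bndD bC b0) => k x; rewrite addrC subrK.
by exists (@OpSeq _ _ (fun m => op (s (L m)) m) (fun m => adj (s (L m)) m)
  (fun m => opP (s (L m)) m) bt).
Qed.

Lemma opalg_complete (a : nat -> opalg H) :
  (forall e : R, 0 < e -> exists N : nat, forall k l : nat,
     (N <= k)%N -> (N <= l)%N -> opalg_norm (a k - a l) < e) ->
  exists x : opalg H, opalg_norm (a k - x) @[k --> \oo] --> (0 : R).
Proof.
move=> cauchy.
pose eps j : R := j.+1%:R^-1.
have eps0 j : 0 < eps j by rewrite invr_gt0.
have /choice [M bM] : forall j, exists N : nat, forall k l : nat,
  (N <= k)%N -> (N <= l)%N -> opalg_norm (a k - a l) < eps j.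
  by move=> j; exact: cauchy.
(* The running maximum puts [phi l] beyond the threshold [M j] for every [j <= l]. *)
pose phi j := (\max_(i < j.+1) M i)%N.
have Mphi j l : (j <= l)%N -> (M j <= phi l)%N.
  move=> jl; exact: (leq_bigmax_cond (F := fun i : 'I_l.+1 => M i)
    (Ordinal (jl : (j < l.+1)%N)) isT).
have [|t bt] := @opalg_fast_complete (fun j => repr (a (phi j))) eps.
  move=> j l jl; apply: cls_normB_lt.
  by rewrite !cls_repr; apply: bM; apply: Mphi.
exists (cls t); apply/cvgrPdist_lt => e e0.
have [j ej] : exists j, eps j < e / 2.
  have e20 : 0 < e / 2 by rewrite divr_gt0.
  by have [j] := ltr_add_invr e20; rewrite add0r; exists j.
near=> k.
rewrite sub0r normrN ger0_norm ?opalg_norm_ge0 //.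
rewrite -(subrK (a (phi j)) (a k)) -addrA (le_lt_trans (opalg_normD _ _)) //.
rewrite (splitr e) ltrD //.
  rewrite (lt_trans _ ej) // bM //; last exact: Mphi.
  by near: k; exact: nbhs_infty_ge.
rewrite -[X in X - _]cls_repr (le_lt_trans _ ej) //.
exact: cls_normB_le (bt j).
Unshelve. all: by end_near. Qed.

HB.instance Definition _ := hasCStar.Build R (opalg H)
  opalg_starK opalg_starD opalg_starZ opalg_starM opalg_normD opalg_normZ
  opalg_norm0_eq0 opalg_normM opalg_norm_cstar opalg_complete.

End OpAlgebraNorm.

(** * The Temperley-Lieb Fock space *)

(* [ann i] and [cre i] are the annihilation and creation operators of the
   Temperley-Lieb Fock space: the recursion for [cre] is Wenzl's formula for the
   Jones-Wenzl projection applied to [e_i (x) x]. *)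
Section OneLeg.
Variables (F : fieldType) (n : nat) (N : nat -> F).
Notation word := (seq 'I_n).

Definition ann (E : Type) (i : 'I_n) (x : word -> E) : word -> E :=
  fun I => x (i :: I).

Fixpoint cre (E : lmodType F) (i : 'I_n) (x : word -> E) (I : word) : E :=
  if I is m :: I' then
    (i == m)%:R *: x I' - N (size I') *: cre m (ann i x) I'
  else 0.

(* All contractions of adjacent indices vanish: [x] lies in the range of the
   Jones-Wenzl projections. *)
Definition planar (E : nmodType) (x : word -> E) : Prop :=
  forall w I, \sum_i x (w ++ i :: i :: I) = 0.

Lemma cre_cons (E : lmodType F) i m (x : word -> E) I :
  cre i x (m :: I) = (i == m)%:R *: x I - N (size I) *: cre m (ann i x) I.
Proof. by []. Qed.

Section Basics.
Variable E : lmodType F.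
Implicit Types (x y : word -> E) (i : 'I_n) (I : word).

(** Coefficients in an arbitrary module let a second leg, or elements of [A], serve as coefficients.
    Naturality then makes creations on different legs commute, and makes creation commute with
    multiplication in [A]. *)
Lemma cre_map (E' : lmodType F) (phi : E -> E') (x : word -> E) i I :
  linear phi -> cre i (phi \o x) I = phi (cre i x I).
Proof.
move=> lin; have phi0 : phi 0 = 0.
  by have := lin (-1) 0 0; rewrite scaler0 add0r scaleN1r addNr.
elim: I i x => [|m I IH] i x /=; first by rewrite phi0.
have phiZ c u : phi (c *: u) = c *: phi u.
  by have := lin c u 0; rewrite !addr0 phi0 addr0.
by rewrite (IH m (ann i x)) addrC -!scaleNr lin phiZ addrC.
Qed.

Lemma cre_lin (a : F) x y i I :
  cre i (fun J => a *: x J + y J) I = a *: cre i x I + cre i y I.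
Proof.
elim: I i x y => [|m I IH] i x y /=; first by rewrite scaler0 addr0.
rewrite (IH m (ann i x) (ann i y)).
by rewrite scalerBr !scalerDr !scalerA opprD addrACA [a * _]mulrC [a * N _]mulrC.
Qed.

Lemma cre0 i I : cre i (fun=> 0 : E) I = 0.
Proof. by elim: I i => [|m I IH] i //=; rewrite (IH m) !scaler0 subrr. Qed.

Lemma cre_sum (T : finType) (f : T -> word -> E) i I :
  cre i (fun J => \sum_t f t J) I = \sum_t cre i (f t) I.
Proof.
elim: I i f => [|m I IH] i f /=; first by rewrite big1.
by rewrite (IH m (fun t => ann i (f t))) sumrB -!scaler_sumr.
Qed.

Lemma cre_degree (g : nat -> F) x i I :
  cre i (fun J => g (size J).+1 *: x J) I = g (size I) *: cre i x I.
Proof.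
elim: I i x g => [|m I IH] i x g /=; first by rewrite scaler0.
rewrite (IH m (ann i x) (fun k => g k.+1)).
by rewrite scalerBr; congr (_ - _); rewrite !scalerA mulrC.
Qed.

Lemma cre_degree_S (g : nat -> F) x i I :
  cre i (fun J => g (size J) *: x J) I = g (size I).-1 *: cre i x I.
Proof. exact: (cre_degree (fun k => g k.-1)). Qed.

Lemma eq_cre x y i I : (forall J, (size J).+1 = size I -> x J = y J) ->
  cre i x I = cre i y I.
Proof.
elim: I i x y => [|m I IH] i x y //= e; rewrite e //.
by rewrite (IH m (ann i x) (ann i y)) // => J eqJ; apply: e; rewrite /= eqJ.
Qed.

Lemma planar_ann x i : planar x -> planar (ann i x).
Proof. by move=> px w I; exact: (px (i :: w)). Qed.

Lemma sum_delta i (f : 'I_n -> E) : \sum_m (m == i)%:R *: f m = f i.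
Proof.
rewrite (bigD1 i) //= eqxx scale1r big1 ?addr0 // => m /negPf ->.
by rewrite scale0r.
Qed.

(** The correction terms add up to [cre m] of a contraction of [x], which is zero. Creation has no
    component on the empty word, hence the exclusion. *)
Lemma cre_ann x I : planar x -> I != [::] -> \sum_i cre i (ann i x) I = x I.
Proof.
move=> px; case: I => [//|m I] _ /=.
rewrite sumrB sum_delta -scaler_sumr.
have -> : \sum_i cre m (ann i (ann i x)) I = 0.
  rewrite -cre_sum -[RHS](cre0 m I); apply: eq_cre => J _.
  exact: (px [::]).
by rewrite scaler0 subr0.
Qed.

End Basics.

Hypothesis N0 : N 0 = 0.
Hypothesis NS : forall k, N k.+1 * (n%:R - N k) = 1.

Section Planar.
Variable E : lmodType F.
Implicit Types (x y : word -> E) (i : 'I_n) (I : word).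

(** The diagonal terms give [n], the correction terms form the sum in [cre_ann]; on the empty word
    [N 0 = 0] replaces that lemma. *)
Lemma ann_cre_sum x I : planar x ->
  \sum_i ann i (cre i x) I = (n%:R - N (size I)) *: x I.
Proof.
move=> px; rewrite /ann /= sumrB -scaler_sumr.
under eq_bigr do rewrite eqxx scale1r.
rewrite sumr_const card_ord -scaler_nat scalerBl; congr (_ - _).
have [->|Inil] := eqVneq I [::]; first by rewrite /= N0 !scale0r.
by rewrite -[in RHS](cre_ann px Inil).
Qed.

(** By [ann_cre_sum] the correction carries the factor [N_k (n - N_(k-1))], which [NS] makes 1, so
    it cancels the main term. *)
Lemma cre_cre x I : planar x -> \sum_i cre i (cre i x) I = 0.
Proof.
move=> px; case: I => [|m I] /=; first by rewrite big1.
rewrite sumrB sum_delta -scaler_sumr -cre_sum.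
rewrite (@eq_cre _ (fun J => \sum_t ann t (cre t x) J)
    (fun J => (n%:R - N (size J)) *: x J)); last first.
  by move=> J _; exact: ann_cre_sum.
rewrite (cre_degree_S (fun k => n%:R - N k)).
case: I => [|m' I]; first by rewrite /= !scaler0 subrr.
by rewrite scalerA NS scale1r subrr.
Qed.

Lemma planar_cre x i : planar x -> planar (cre i x).
Proof.
move=> px w; elim: w i x px => [|m w IH] i x px I /=.
  rewrite sumrB.
  under eq_bigr do rewrite [i == _]eq_sym.
  rewrite (sum_delta i (fun m => x (m :: I))) -scaler_sumr /=.
  have -> : \sum_m ((m == m)%:R *: ann i x I - N (size I) *: cre m (ann m (ann i x)) I)
          = \sum_m ann m (cre m (ann i x)) I by [].
  by rewrite ann_cre_sum ?scalerA ?NS ?scale1r ?subrr //; exact: planar_ann.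
rewrite sumrB -!scaler_sumr px scaler0 sub0r.
under eq_bigr => j _ do rewrite size_cat /=.
rewrite -scaler_sumr IH ?scaler0 ?oppr0 //; exact: planar_ann.
Qed.

End Planar.

End OneLeg.

Arguments ann {n E} i x I : simpl never.

(** * The Fock operators on two legs and their orthogonality relations *)

Section TwoLegs.
Variables (F : fieldType) (n : nat) (N : nat -> F).
Notation word := (seq 'I_n).
Notation cre := (cre N).
Hypothesis N0 : N 0 = 0.
Hypothesis NS : forall k, N k.+1 * (n%:R - N k) = 1.

Lemma linear_cre (E : lmodType F) i (I : word) : linear (fun x : word -> E => cre i x I).
Proof. by move=> a x y; rewrite -cre_lin. Qed.

Lemma linear_cre_fun (E : lmodType F) i : linear (cre i : (word -> E) -> (word -> E)).
Proof. by move=> a x y; apply/funext => I; rewrite [LHS]linear_cre. Qed.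

Lemma linear_ann_fun (E : lmodType F) (i : 'I_n) : linear (@ann n E i).
Proof. by []. Qed.

Lemma planarD (E : lmodType F) a (x y : word -> E) :
  planar x -> planar y -> planar (fun I => a *: x I + y I).
Proof. by move=> px py w I; rewrite big_split /= -scaler_sumr px py scaler0 addr0. Qed.

Lemma planar_degree (E : lmodType F) (g : nat -> F) (x : word -> E) :
  planar x -> planar (fun I => g (size I) *: x I).
Proof.
move=> px w I; under eq_bigr => i _ do rewrite size_cat /=.
by rewrite -scaler_sumr px scaler0.
Qed.

Lemma planar0 (E : lmodType F) : planar (fun _ : word => 0 : E).
Proof. by move=> w I; rewrite big1. Qed.

Lemma linear_sum_map (E E' : lmodType F) (phi : E -> E') (T : finType) (f : T -> E) :
  linear phi -> phi (\sum_t f t) = \sum_t phi (f t).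
Proof.
move=> lin; have phi0 : phi 0 = 0.
  by have := lin (-1) 0 0; rewrite scaler0 add0r scaleN1r addNr.
apply: (big_morph phi _ phi0) => u v.
by have := lin 1 u v; rewrite !scale1r.
Qed.

Lemma planar_map (E E' : lmodType F) (phi : E -> E') (x : word -> E) :
  linear phi -> planar x -> planar (phi \o x).
Proof.
move=> lin px w I; rewrite -(linear_sum_map _ lin) px.
by have := lin (-1) 0 0; rewrite scaler0 add0r scaleN1r addNr.
Qed.

Definition bitensor := word -> word -> F^o.
Implicit Types (X Y : bitensor) (i j : 'I_n) (I J : word).

Definition biplanar X : Prop := planar X /\ forall I, planar (X I).

Definition bisupport K X : Prop :=
  forall I J, ~~ ((size I == size J) && (size I < K)%N) -> X I J = 0.

(** [I] is the word left after annihilation, so [(size I).+1] is the degree of the vector that is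
    annihilated. *)
Definition fund i j X : bitensor := fun I =>
  cre j (cre i X I) + N (size I).+1 *: ann j (X (i :: I)).

Lemma fundE i j X I J :
  fund i j X I J = cre j (cre i X I) J + N (size I).+1 *: X (i :: I) (j :: J).
Proof. by []. Qed.

Lemma cre_pt i X I J : cre i X I J = cre i (X^~ J) I.
Proof. exact/esym/(@cre_map _ _ _ _ _ (fun y : word -> F^o => y J) X). Qed.

Lemma cre_swap i j X I J : cre j (cre i X I) J = cre i (fun I' => cre j (X I') J) I.
Proof.
exact/esym/(@cre_map _ _ _ _ _ (fun y : word -> F^o => cre j y J) X)/linear_cre.
Qed.

Lemma planar_cre_pt i X I : (forall I', planar (X I')) -> planar (cre i X I).
Proof.
elim: I i X => [|m I IH] i X pX; first exact: planar0.
rewrite /= addrC -scaleNr; apply: planarD; first by apply: (IH m) => J; exact: pX.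
by move=> w J; rewrite -scaler_sumr pX scaler0.
Qed.

Lemma biplanar_fund i j X : biplanar X -> biplanar (fund i j X).
Proof.
move=> [p1 p2]; split.
  rewrite /fund (_ : (fun I => _) = fun I =>
    1 *: (fun I => N (size I).+1 *: ann j (X (i :: I))) I
    + (cre j \o cre i X) I); last by apply/funext => I; rewrite scale1r addrC.
  apply: planarD.
    apply: (planar_degree (fun k => N k.+1)).
    exact: (planar_map (@linear_ann_fun _ j) (planar_ann i p1)).
  by apply: planar_map; [exact: linear_cre_fun|exact: planar_cre].
move=> I; rewrite /fund addrC; apply: planarD; first exact: planar_ann.
by apply: planar_cre => //; exact: planar_cre_pt.
Qed.

Lemma bisupport_fund K i j X : bisupport K X -> bisupport K.+1 (fund i j X).
Proof.
move=> sX I J h; rewrite fundE [X _ _]sX; last first.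
  by apply: contra h; rewrite /= eqSS => /andP[-> /ltnW/ltnW].
rewrite scaler0 addr0; case: J h => [//|m J] h.
transitivity (cre j (fun _ : word => 0 : F^o) (m :: J)); last exact: cre0.
apply: eq_cre => J' eJ; rewrite cre_pt.
transitivity (cre i (fun _ : word => 0 : F^o) I); last exact: cre0.
apply: eq_cre => I' eI; apply: sX; apply: contra h.
by rewrite -eI -eJ ltnS eqSS.
Qed.

Lemma creD (E : lmodType F) (x y : word -> E) i I :
  cre i (fun J => x J + y J) I = cre i x I + cre i y I.
Proof.
rewrite -[cre i x I]scale1r -cre_lin; congr (cre _ _ _).
by apply/funext => J; rewrite scale1r.
Qed.

Lemma fund_lin i j (a : F) X Y I J :
  fund i j (fun I J => a *: X I J + Y I J) I J = a *: fund i j X I J + fund i j Y I J.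
Proof.
rewrite !fundE [in RHS]scalerDr [RHS]addrACA !cre_swap -cre_lin; congr (_ + _).
  by congr (cre _ _ _); apply/funext => I'; rewrite -cre_lin.
by rewrite scalerDr !scalerA mulrC.
Qed.

Lemma cre_fund i j l X I J : cre i (fund j l X) I J =
  cre l (cre i (cre j X) I) J + N (size I) *: ann l (cre i (ann j X) I) J.
Proof.
rewrite cre_pt (creD (fun I' => cre l (cre j X I') J)) -cre_swap; congr (_ + _).
by rewrite (cre_degree _ N) /ann cre_pt.
Qed.

(** Of the four products, two creations on the second leg vanish by [cre_cre] and two annihilations
    by planarity. The mixed ones give [N_k cre_i ann_j X], by [cre_ann], and [cre_j X] read at
    [i :: I], by [ann_cre_sum] and [NS]. Wenzl's recursion for the latter leaves only the Kronecker
    term. Equal lengths let the factor [N] of one leg cancel against that of the other. *)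
Lemma fund_fund_sum i j X I J : biplanar X -> size I = size J ->
  \sum_l fund i l (fund j l X) I J = (i == j)%:R *: X I J.
Proof.
move=> [p1 p2] eIJ.
have pX k I' : planar (cre k X I') by exact: planar_cre_pt.
have step l : fund i l (fund j l X) I J =
    cre l (cre l (cre i (cre j X) I)) J
    + N (size I) *: cre l (ann l (cre i (ann j X) I)) J
    + N (size I).+1 *: (ann l (cre l (cre j X (i :: I))) J
    + N (size I).+2 *: ann l (ann l (X (j :: i :: I))) J).
  rewrite fundE; congr (_ + _).
  have -> : cre i (fund j l X) I = fun J => N (size I) *: ann l (cre i (ann j X) I) J
      + cre l (cre i (cre j X) I) J.
    by apply/funext => J'; rewrite cre_fund addrC.
  by rewrite cre_lin addrC.
under eq_bigr do rewrite step.
rewrite !big_split -!scaler_sumr big_split -scaler_sumr.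
rewrite (cre_cre N0 NS); last by apply: planar_cre_pt.
rewrite (ann_cre_sum N0); last exact: pX.
have -> : \sum_l ann l (ann l (X (j :: i :: I))) J = 0 by exact: (p2 _ [::]).
rewrite /= scaler0 addr0 add0r scalerA -eIJ NS scale1r [j == i]eq_sym.
rewrite -[X in _ + X = _]/((i == j)%:R *: X I J - N (size I) *: cre i (ann j X) I J).
have [I0|In0] := eqVneq I [::].
  by rewrite I0 /= N0 !scale0r add0r subr0.
rewrite cre_ann; last by rewrite -size_eq0 -eIJ size_eq0.
  by rewrite addrCA subrr addr0.
by apply: planar_cre_pt => I'; exact: p2.
Qed.

Definition flip X : bitensor := fun I J => X J I.

Lemma bisupport_flip K X : bisupport K X -> bisupport K (flip X).
Proof.
move=> sX I J h; apply: sX; apply: contra h => /andP[/eqP->].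
by rewrite eqxx.
Qed.

Lemma biplanar_flip X : biplanar X -> biplanar (flip X).
Proof.
move=> [p1 p2]; split=> [w J|J w I].
  by apply/funext => I; rewrite fct_sumE; exact: p2.
have := congr1 (fun f : word -> F^o => f J) (p1 w I).
by rewrite fct_sumE.
Qed.

(** [fund] reads the degree on the first leg; on words of equal length this choice is symmetric.
    Exchanging the legs turns the row relations into the column relations. *)
Lemma fund_flip K i j X I J : bisupport K X -> fund i j X I J = fund j i (flip X) J I.
Proof.
move=> sX; have [eIJ|nIJ] := eqVneq (size I) (size J); last first.
  rewrite (bisupport_fund i j sX) ?(negPf nIJ) //.
  by rewrite (bisupport_fund j i (bisupport_flip sX)) // eq_sym (negPf nIJ).
rewrite !fundE eIJ; congr (_ + _).
by rewrite cre_swap; congr (cre _ _ _); apply/funext => I'; rewrite [RHS]cre_pt.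
Qed.

Lemma fund_orthogonal_row K i j X : biplanar X -> bisupport K X ->
  \sum_l fund i l (fund j l X) = (i == j)%:R *: X.
Proof.
move=> pX sX; apply/funext => I; apply/funext => J; rewrite !fct_sumE.
rewrite -[RHS]/((i == j)%:R *: X I J).
have [eIJ|nIJ] := eqVneq (size I) (size J); first exact: fund_fund_sum.
rewrite sX ?(negPf nIJ) // scaler0 big1 // => l _.
by rewrite (bisupport_fund i l (bisupport_fund j l sX)) // (negPf nIJ).
Qed.

Lemma fund_orthogonal_col K i j X : biplanar X -> bisupport K X ->
  \sum_l fund l i (fund l j X) = (i == j)%:R *: X.
Proof.
move=> pX sX; rewrite -[X in _ *: X]/(flip (flip X)).
have -> : (i == j)%:R *: flip (flip X) = flip ((i == j)%:R *: flip X) by [].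
rewrite -(fund_orthogonal_row i j (biplanar_flip pX) (bisupport_flip sX)).
apply/funext => I; apply/funext => J; rewrite /flip !fct_sumE.
apply: eq_bigr => l _; rewrite (fund_flip _ _ _ _ (bisupport_fund l j sX)).
congr (fund i l _ J I); apply/funext => I'; apply/funext => J'.
exact: fund_flip sX.
Qed.

End TwoLegs.

(** * Sums over words; annihilation as the transpose of creation *)

Section Words.
Variable n : nat.
Notation word := (seq 'I_n).

Fixpoint words k : seq word :=
  if k is k'.+1 then [seq i :: w | i <- index_enum 'I_n, w <- words k'] else [:: [::]].

Lemma sum_wordsS (V : nmodType) k (f : word -> V) :
  \sum_(I <- words k.+1) f I = \sum_i \sum_(I <- words k) f (i :: I).
Proof. exact: big_allpairs_dep. Qed.

Lemma size_words k I : I \in words k -> size I = k.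
Proof.
elim: k I => [|k IH] I; first by rewrite inE => /eqP->.
by move=> /allpairsPdep[i [J [_ /IH <- ->]]].
Qed.

Lemma eq_sum_words (V : nmodType) k (f g : word -> V) :
  (forall I, size I = k -> f I = g I) ->
  \sum_(I <- words k) f I = \sum_(I <- words k) g I.
Proof. by move=> e; apply: eq_big_seq => I /size_words /e. Qed.

(** The correction in Wenzl's recursion is orthogonal to planar vectors: by induction it pairs
    [ann i x] with a contraction of [y]. *)
Lemma cre_dual (F : fieldType) (N : nat -> F) k i (x y : word -> F^o) : planar y ->
  \sum_(I <- words k.+1) cre N i x I * y I = \sum_(I <- words k) x I * y (i :: I).
Proof.
elim: k i x y => [|k IH] i x y py.
  rewrite sum_wordsS big_seq1.
  under eq_bigr => m _ do rewrite big_seq1 /= scaler0 subr0.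
  rewrite (bigD1 i) //= eqxx scale1r big1 ?addr0 // => m /negPf mi.
  by rewrite eq_sym mi scale0r mul0r.
rewrite sum_wordsS.
under eq_bigr => m _ do (under eq_bigr => I _ do rewrite cre_cons mulrBl; rewrite sumrB).
rewrite sumrB [X in _ - X](_ : _ = 0) ?subr0.
  rewrite (bigD1 i) //= [X in _ + X]big1 ?addr0 => [|m /negPf mi].
    by under eq_bigr => I _ do rewrite eqxx scale1r.
  by rewrite big1 // => I _; rewrite eq_sym mi scale0r mul0r.
transitivity (\sum_m N k.+1 * \sum_(I <- words k.+1) cre N m (ann i x) I * ann m y I).
  apply: eq_bigr => m _; rewrite mulr_sumr; apply: eq_sum_words => I ->.
  by rewrite -mulrA.
rewrite -mulr_sumr [X in _ * X](_ : _ = 0) ?mulr0 //.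
transitivity (\sum_m \sum_(I <- words k) ann i x I * y (m :: m :: I)).
  by apply: eq_bigr => m _; rewrite IH //; exact: planar_ann.
rewrite exchange_big big1 //= => I _.
by rewrite -mulr_sumr [X in _ * X](py [::]) mulr0.
Qed.

End Words.

(** * The pre-Hilbert space of finitely supported Fock vectors *)

Section Fock.
Variables (R : realType) (n : nat).
Notation word := (seq 'I_n).
Local Notation C := R[i].
Implicit Types (i j : 'I_n) (I J : word).

(* The ratio of quantum integers [[k]/[k+1]] with [[2] = n]. *)
Fixpoint wenzl k : R := if k is k'.+1 then (n%:R - wenzl k')^-1 else 0.
Definition wenzlC k : C := (wenzl k)%:C.

Definition fock_pred : pred (word -> word -> C^o) :=
  fun X => `[< biplanar X /\ exists K, bisupport K X >].

Record fock := Fock { fock_val :> word -> word -> C^o; _ : fock_val \in fock_pred }.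
HB.instance Definition _ := [isSub for fock_val].
HB.instance Definition _ := [Choice of fock by <:].

Lemma fock_submod : submod_closed fock_pred.
Proof.
split; first by apply/asboolP; split; [split=> [|I]; exact: planar0|exists 0%N].
move=> a X Y /asboolP[[p1 p2] [K sX]] /asboolP[[q1 q2] [L sY]]; apply/asboolP.
split; [split=> [|I]|exists (maxn K L)].
- exact: planarD.
- exact: planarD.
move=> I J h; rewrite -[LHS]/(a *: X I J + Y I J) sX ?sY ?scaler0 ?addr0 //.
  by apply: contra h => /andP[-> /leq_trans->] //; rewrite leq_maxr.
by apply: contra h => /andP[-> /leq_trans->] //; rewrite leq_maxl.
Qed.

HB.instance Definition _ :=
  GRing.isSubmodClosed.Build C (word -> word -> C^o) fock_pred fock_submod.
HB.instance Definition _ := [SubChoice_isSubLmodule of fock by <:].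

Lemma fockP (X : fock) : biplanar X /\ exists K, bisupport K X.
Proof. by case: X => X /= /asboolP. Qed.

Lemma bisupport_le K L (X : bitensor C n) : (K <= L)%N -> bisupport K X -> bisupport L X.
Proof.
move=> le sX I J h; apply: sX; apply: contra h => /andP[-> /leq_trans].
exact.
Qed.

Lemma bisupport_common (s : seq fock) : exists K, forall X, X \in s -> bisupport K X.
Proof.
elim: s => [|X s [K IH]]; first by exists 0%N.
have [_ [L sX]] := fockP X; exists (maxn K L) => Y; rewrite inE.
case/orP => [/eqP->|/IH sY].
  exact: bisupport_le (leq_maxr _ _) sX.
exact: bisupport_le (leq_maxl _ _) sY.
Qed.

(* Peter-Weyl weights [1 / dim H_k]; they make the operators [fund] self-adjoint. *)
Definition weight k : C := \prod_(l < k) wenzlC l.+1.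

Definition slice k (X Y : bitensor C n) : C :=
  \sum_(I <- words n k) \sum_(J <- words n k) X I J * (Y I J)^*.

Definition fock_deg (X : fock) : nat := projT1 (cid (fockP X).2).

Definition fock_form (X Y : fock) : C :=
  \sum_(k < fock_deg X) weight k * slice k X Y.

Lemma slice_support K k (X Y : bitensor C n) : bisupport K X -> (K <= k)%N ->
  slice k X Y = 0.
Proof.
move=> sX le; rewrite /slice big_seq big1 // => I /size_words sI.
rewrite big1 // => J _; rewrite sX ?mul0r // negb_and sI -leqNgt le.
by rewrite orbT.
Qed.

(** [fock_deg] is an arbitrarily chosen support bound. Slices beyond a bound vanish, so several
    vectors may share one. *)
Lemma fock_formE K (X Y : fock) : bisupport K X ->
  fock_form X Y = \sum_(k < K) weight k * slice k X Y.
Proof.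
have widen L M : bisupport L X -> (L <= M)%N ->
    \sum_(k < M) weight k * slice k X Y = \sum_(k < L) weight k * slice k X Y.
  move=> sX le.
  rewrite -!(big_mkord xpredT (fun k => weight k * slice k X Y)).
  rewrite (@big_cat_nat _ _ _ L) //= [X in _ + X]big1_seq ?addr0 // => k.
  by rewrite mem_index_iota => /andP[_ /andP[Lk _]]; rewrite (slice_support _ sX) ?mulr0.
move=> sX; rewrite /fock_form /fock_deg; case: cid => L /= sL.
by case: (leqP L K) => [|/ltnW] /widen ->.
Qed.

Lemma sliceC k (X Y : bitensor C n) : slice k Y X = (slice k X Y)^*%R.
Proof.
rewrite /slice rmorph_sum; apply: eq_bigr => I _; rewrite rmorph_sum.
by apply: eq_bigr => J _; rewrite rmorphM /= conjCK mulrC.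
Qed.

Lemma weight_real k : (weight k)^*%R = weight k.
Proof.
by rewrite rmorph_prod; apply: eq_bigr => l _; exact: conjc_real.
Qed.

Lemma fock_formC X Y : fock_form Y X = (fock_form X Y)^*%R.
Proof.
have [K sK] := bisupport_common [:: X; Y].
have [sX sY] : bisupport K X /\ bisupport K Y by split; apply: sK; rewrite !inE eqxx ?orbT.
rewrite (fock_formE _ sX) (fock_formE _ sY) rmorph_sum; apply: eq_bigr => k _.
by rewrite rmorphM /= -sliceC weight_real.
Qed.

Lemma fock_formDl X Y Z : fock_form (X + Y) Z = fock_form X Z + fock_form Y Z.
Proof.
have [K sK] := bisupport_common [:: X; Y; X + Y].
rewrite !(@fock_formE K); try by apply: sK; rewrite !inE eqxx ?orbT.
rewrite -big_split; apply: eq_bigr => k _ /=; rewrite -mulrDr; congr (_ * _).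
rewrite /slice -big_split; apply: eq_bigr => I _ /=; rewrite -big_split.
by apply: eq_bigr => J _ /=; rewrite -mulrDl.
Qed.

Lemma fock_formZl (c : C) X Y : fock_form (c *: X) Y = c * fock_form X Y.
Proof.
have [K sK] := bisupport_common [:: X; c *: X].
rewrite !(@fock_formE K); try by apply: sK; rewrite !inE eqxx ?orbT.
rewrite mulr_sumr; apply: eq_bigr => k _; rewrite mulrCA; congr (_ * _).
rewrite /slice mulr_sumr; apply: eq_bigr => I _; rewrite mulr_sumr.
by apply: eq_bigr => J _; rewrite mulrA.
Qed.

Hypothesis n2 : (2 < n)%N.

Lemma wenzl_bounds k : 0 <= wenzl k < 1.
Proof.
have n3 : 3 <= n%:R :> R by rewrite ler_nat.
elim: k => [|k /andP[w0 w1]] /=; first by rewrite lexx ltr01.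
have p : 1 < n%:R - wenzl k by lra.
by rewrite invr_ge0 invf_lt1 ?p ?(ltW (lt_trans ltr01 p)) ?(lt_trans ltr01 p).
Qed.

Lemma wenzlC0 : wenzlC 0 = 0. Proof. by []. Qed.

Lemma wenzlCS k : wenzlC k.+1 * (n%:R - wenzlC k) = 1.
Proof.
have n3 : 3 <= n%:R :> R by rewrite ler_nat.
have /andP[_ w1] := wenzl_bounds k.
have p : n%:R - wenzl k != 0 by rewrite gt_eqF //; lra.
rewrite /wenzlC -(rmorph_nat (real_complex R)) -rmorphB -rmorphM /= mulVf //.
Qed.

Lemma weight_ge0 k : 0 <= weight k.
Proof.
by apply: prodr_ge0 => l _; rewrite lecR; case/andP: (wenzl_bounds l.+1).
Qed.

Lemma fock_form_nonneg X : 0 <= fock_form X X.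
Proof.
apply: sumr_ge0 => k _; rewrite mulr_ge0 ?weight_ge0 //.
by apply: sumr_ge0 => I _; apply: sumr_ge0 => J _; exact: mul_conjC_ge0.
Qed.

Lemma fock_form_ge0 X : 0 <= Re (fock_form X X).
Proof. by have := fock_form_nonneg X; rewrite lecE => /andP[]. Qed.

Definition vacuum_fun : bitensor C n := fun I J => ((I == [::]) && (J == [::]))%:R.

Lemma vacuum_subproof : vacuum_fun \in fock_pred.
Proof.
apply/asboolP; split; [split=> [w I|J w I]|exists 1%N => I J].
- rewrite big1 // => l _; apply/funext => J; rewrite /vacuum_fun.
  by case: w.
- by rewrite big1 // => l _; rewrite /vacuum_fun andbC; case: w.
by rewrite /vacuum_fun; case: I J => [|i I] [|j J].
Qed.

Definition vacuum := Fock vacuum_subproof.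

Lemma fock_form_vacuum X : fock_form X vacuum = X [::] [::].
Proof.
rewrite fock_formC (@fock_formE 1); last first.
  by move=> I J; rewrite /= /vacuum_fun; case: I J => [|i I] [|j J].
rewrite big_ord1 /weight big_ord0 mul1r /slice !big_seq1 /= /vacuum_fun /= mul1r.
by rewrite conjCK.
Qed.

Lemma fock_nontrivial : exists X, 0 < Re (fock_form X X).
Proof. by exists vacuum; rewrite fock_form_vacuum /= ltr01. Qed.

Definition fock_hilbert : pre_hilbert R :=
  PreHilbert fock_formDl fock_formZl fock_formC fock_form_ge0 fock_nontrivial.

End Fock.

(** * The Fock representation of the free orthogonal matrix *)

Section FockRepresentation.
Variables (R : realType) (n : nat).
Notation word := (seq 'I_n).
Local Notation C := R[i].
Hypothesis n2 : (2 < n)%N.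
Local Notation N := (wenzlC R n).
Local Notation N0 := (wenzlC0 R n).
Local Notation NS := (wenzlCS R n2).
Implicit Types (i j : 'I_n) (I J : word) (X Y : fock R n).

Lemma fund_fock_subproof i j X : fund N i j X \in @fock_pred R n.
Proof.
have [pX [K sX]] := fockP X; apply/asboolP; split.
  exact: biplanar_fund N0 NS _ _ _ pX.
by exists K.+1; exact: bisupport_fund.
Qed.

Definition fund_fock i j X : fock R n := Fock (fund_fock_subproof i j X).

(** The unweighted pairing of the creation part of [fund i j X] with [Y] in degree [k + 1], both
    creations having been moved to [Y]. *)
Definition raise i j k X Y : C :=
  \sum_(I <- words n k) \sum_(J <- words n k) X I J * (Y (i :: I) (j :: J))^*.

Lemma slice_create i j k X Y :
  slice k.+1 (fun I J => cre N j (cre N i X I) J) Y = raise i j k X Y.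
Proof.
have [[p1 p2] _] := fockP Y.
have planarJ (f : word -> C^o) : planar f -> planar (fun I => (f I)^* : C^o).
  by move=> pf w I; rewrite -rmorph_sum pf rmorph0.
rewrite /slice.
transitivity (\sum_(I <- words n k.+1) \sum_(J <- words n k)
    cre N i X I J * (Y I (j :: J))^*).
  apply: eq_bigr => I _.
  exact: (cre_dual N k j (cre N i X I) (planarJ _ (p2 I))).
rewrite exchange_big /raise [RHS]exchange_big; apply: eq_bigr => J _ /=.
under eq_bigr => I _ do rewrite cre_pt.
apply: (cre_dual N k i (fun I => X I J) (y := fun I => (Y I (j :: J))^* : C^o)).
apply: planarJ => w I.
have := congr1 (fun f : word -> C^o => f (j :: J)) (p1 w I).
by rewrite fct_sumE.
Qed.

Lemma slice_annihilate i j k X Y :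
  slice k (fun I J => N (size I).+1 *: X (i :: I) (j :: J) : C^o) Y =
  N k.+1 * (raise i j k Y X)^*%R.
Proof.
rewrite /raise rmorph_sum mulr_sumr; apply: eq_sum_words => I sI.
rewrite rmorph_sum mulr_sumr; apply: eq_bigr => J _.
by rewrite rmorphM /= conjCK sI -mulrA [_^* * _]mulrC.
Qed.

(** Creation into degree [k + 1] carries the weight of [k + 1]; annihilation into degree [k] carries
    that of [k] times [N_(k+1)], the same number. The resulting sum is Hermitian in [X] and [Y],
    whence self-adjointness. *)
Lemma form_fund K i j X Y : bisupport K X ->
  fock_form (fund_fock i j X) Y =
  \sum_(k < K) weight R n k.+1 * (raise i j k X Y + (raise i j k Y X)^*%R).
Proof.
move=> sX; rewrite (@fock_formE _ _ K.+1); last exact: bisupport_fund.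
have split k : slice k (fund N i j X) Y =
    slice k (fun I J => cre N j (cre N i X I) J) Y + N k.+1 * (raise i j k Y X)^*%R.
  rewrite -slice_annihilate /slice -big_split; apply: eq_bigr => I _ /=.
  by rewrite -big_split; apply: eq_bigr => J _ /=; rewrite -mulrDl.
under eq_bigr do rewrite split mulrDr.
rewrite big_split /= big_ord_recl big_ord_recr /=.
have -> : slice 0 (fun I J => cre N j (cre N i X I) J) Y = 0.
  by rewrite /slice !big_seq1 mul0r.
have -> : raise i j K Y X = 0.
  rewrite /raise big_seq big1 // => I /size_words sI.
  rewrite big1 // => J _; rewrite sX ?rmorph0 ?mulr0 //=.
  by rewrite negb_and sI ltnNge leqnSn orbT.
rewrite mulr0 add0r rmorph0 !mulr0 addr0 -big_split; apply: eq_bigr => k _ /=.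
rewrite slice_create mulrDr; congr (_ + _).
by rewrite mulrA /weight big_ord_recr.
Qed.

Lemma fund_fock_adj i j X Y :
  fock_form (fund_fock i j X) Y = fock_form X (fund_fock i j Y).
Proof.
have [K sK] := bisupport_common [:: X; Y].
rewrite [RHS]fock_formC !(@form_fund K); try by apply: sK; rewrite !inE eqxx ?orbT.
rewrite rmorph_sum; apply: eq_bigr => k _.
by rewrite rmorphM rmorphD /= conjCK weight_real addrC.
Qed.

Lemma fund_fock_row i j X :
  \sum_l fund_fock i l (fund_fock j l X) = (i == j)%:R *: X.
Proof.
have [pX [K sX]] := fockP X; apply: val_inj; rewrite raddf_sum linearZ /=.
exact: (fund_orthogonal_row N0 NS i j pX sX).
Qed.

Lemma fund_fock_col i j X :
  \sum_l fund_fock l i (fund_fock l j X) = (i == j)%:R *: X.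
Proof.
have [pX [K sX]] := fockP X; apply: val_inj; rewrite raddf_sum linearZ /=.
exact: (fund_orthogonal_col N0 NS i j pX sX).
Qed.

Local Notation H := (fock_hilbert R n2).

(** The column relation and self-adjointness split [|X|^2] into the sum over [l] of
    [|fund_fock l j X|^2], so each operator is a contraction. *)
Lemma fund_fock_bounded i j :
  exists c : R, 0 <= c /\ forall X : H, nrm (fund_fock i j X : H) <= c * nrm X.
Proof.
exists 1; split=> // X; rewrite mul1r ler_sqrt ?form_ge0 //.
have sumE : fock_form X X = \sum_l fock_form (fund_fock l j X) (fund_fock l j X).
  transitivity (fock_form (\sum_l fund_fock l j (fund_fock l j X)) X).
    by rewrite fund_fock_col eqxx scale1r.
  have lin : {morph (fun Z => fock_form Z X) : Y Z / Y + Z}.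
    by move=> Y Z; exact: fock_formDl.
  rewrite (big_morph _ lin (form0l (H := H) X)); apply: eq_bigr => l _.
  by rewrite fund_fock_adj.
rewrite /= sumE (bigD1 i) //= ReD lerDl.
suff : 0 <= \sum_(l | l != i) fock_form (fund_fock l j X) (fund_fock l j X).
  by rewrite lecE => /andP[].
by apply: sumr_ge0 => l _; exact: fock_form_nonneg.
Qed.

Definition fund_op i j : opalg H := cls (@opseq_const _ H _ _
  (fund_fock_adj i j : forall X Y : H, _) (fund_fock_bounded i j)).

(** Singles out the classes of constant sequences. Polynomials in the generators are of this kind,
    and only these need a vacuum expectation. *)
Definition acts (a : opalg H) (T : H -> H) : Prop :=
  exists2 s, a = cls s & forall k, op s k =1 T.

Lemma acts_fund i j : acts (fund_op i j) (fund_fock i j).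
Proof. by eexists; first reflexivity. Qed.

Lemma acts1 : acts 1 id.
Proof. by exists (opseq_one H). Qed.

Lemma acts0 : acts 0 (fun=> 0).
Proof. by exists (opseq_zero H). Qed.

Lemma actsD a b T S : acts a T -> acts b S -> acts (a + b) (fun X => T X + S X).
Proof.
move=> [s -> sT] [t -> tS]; exists (opseq_add s t) => [|k X /=]; first exact: clsD.
by rewrite sT tS.
Qed.

Lemma actsM a b T S : acts a T -> acts b S -> acts (a * b) (T \o S).
Proof.
move=> [s -> sT] [t -> tS]; exists (opseq_mul s t) => [|k X /=]; first exact: clsM.
by rewrite sT tS.
Qed.

Lemma actsZ (c : C) a T : acts a T -> acts (c *: a) (fun X => c *: T X).
Proof.
move=> [s -> sT]; exists (opseq_scale c s) => [|k X /=]; first exact: clsZ.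
by rewrite sT.
Qed.

Lemma acts_sum (P : Type) (r : seq P) (a : P -> opalg H) (T : P -> H -> H) :
  (forall p, acts (a p) (T p)) ->
  acts (\sum_(p <- r) a p) (fun X => \sum_(p <- r) T p X).
Proof.
move=> aT; elim: r => [|p r IH].
  by rewrite big_nil; case: acts0 => s -> sT; exists s => // k X; rewrite big_nil sT.
rewrite big_cons; case: (actsD (aT p) IH) => s -> sT.
by exists s => // k X; rewrite big_cons sT.
Qed.

Lemma acts_inj a b T : acts a T -> acts b T -> a = b.
Proof.
by move=> [s -> sT] [t -> tT]; apply: cls_form => k X Y; rewrite sT tT.
Qed.

(** Two constant representatives differ by vectors of norm zero, which are orthogonal to the
    vacuum. *)
Lemma acts_vacuum a T S X : acts a T -> acts a S ->
  (T X : fock R n) [::] [::] = (S X : fock R n) [::] [::].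
Proof.
move=> [s -> sT] [t st tS]; have /clsP sim := st.
pose D : fock R n := T X - S X.
have nD : nrm (D : H) = 0.
  apply/eqP; rewrite eq_le nrm_ge0 andbT; apply/ler_addgt0Pr => e e0.
  rewrite add0r; have x1 : 0 < nrm (X : H) + 1 by rewrite ltr_wpDl ?nrm_ge0.
  have [_ [K /(_ K X (leqnn K))]] := sim _ (divr_gt0 e0 x1).
  rewrite sT tS => /le_trans; apply.
  by rewrite mulrAC ler_pdivrMr // ler_pM2l // lerDl.
have D0 : D [::] [::] = 0.
  (* Scaling the vacuum by the coordinate itself makes the pairing its squared modulus, so the bound
     on real parts suffices. *)
  have := form_cauchy_schwarz (D : H) (D [::] [::] *: vacuum R n : H).
  rewrite nD mul0r [form _ _]formZr [form _ _]fock_form_vacuum.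
  case: (D [::] [::]) => a1 b1 /= le0.
  have a0 : a1 = 0 by apply/eqP; rewrite -sqrf_eq0 eq_le sqr_ge0 andbT; nra.
  have b0 : b1 = 0 by apply/eqP; rewrite -sqrf_eq0 eq_le sqr_ge0 andbT; nra.
  by rewrite a0 b0.
by apply/eqP; rewrite -subr_eq0; apply/eqP.
Qed.

Definition fund_mx : 'M[opalg H]_n := \matrix_(i, j) fund_op i j.

Lemma fund_mx_orthogonal : orthogonal_relations fund_mx.
Proof.
have one_acts (i j : 'I_n) : acts ((i == j)%:R) (fun X => (i == j)%:R *: X).
  case: (i == j).
    by have [s es sT] := acts1; exists s => // k X; rewrite sT scale1r.
  by have [s es sT] := acts0; exists s => // k X; rewrite sT scale0r.
split=> [i j||].
- rewrite mxE; change (opalg_star (fund_op i j) = fund_op i j).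
  by rewrite /fund_op cls_star; apply: cls_form.
- apply/matrixP => i j; rewrite !mxE.
  under eq_bigr do rewrite !mxE.
  apply: (acts_inj (acts_sum _ (fun l => actsM (acts_fund i l) (acts_fund j l)))).
  have [s es sT] := one_acts i j; exists s => // k X.
  by rewrite sT -fund_fock_row.
- apply/matrixP => i j; rewrite !mxE.
  under eq_bigr do rewrite !mxE.
  apply: (acts_inj (acts_sum _ (fun l => actsM (acts_fund l i) (acts_fund l j)))).
  have [s es sT] := one_acts i j; exists s => // k X.
  by rewrite sT -fund_fock_col.
Qed.

End FockRepresentation.

(** * Haar moments are vacuum moments *)

Section Monomials.
Variables (F : fieldType) (n : nat) (A : algType F) (u : 'M[A]_n).
Notation word := (seq 'I_n).
Implicit Types (i j k m : 'I_n) (I J K L M : word).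

(** Entry [(I, K)] of a tensor power of [u]. *)
Fixpoint mon I K : A :=
  match I, K with
  | [::], [::] => 1
  | i :: I', k :: K' => u i k * mon I' K'
  | _, _ => 0
  end.

Variable N : nat -> F.
Notation cre := (cre N).
Hypothesis u_row : u *m u^T = 1%:M.
Hypothesis u_col : u^T *m u = 1%:M.

Lemma u_rowE i j : \sum_l u i l * u j l = (i == j)%:R.
Proof.
have := congr1 (fun B : 'M[A]_n => B i j) u_row; rewrite !mxE => <-.
by apply: eq_bigr => l _; rewrite mxE.
Qed.

Lemma u_colE i j : \sum_l u l i * u l j = (i == j)%:R.
Proof.
have := congr1 (fun B : 'M[A]_n => B i j) u_col; rewrite !mxE => <-.
by apply: eq_bigr => l _; rewrite mxE.
Qed.

(** The tensor power of [u] applied to the vector [y]: the coaction on words of each length. *)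
Definition corep (y : word -> F^o) L : A := \sum_(M <- words n (size L)) y M *: mon L M.

Lemma linear_corep L : linear (corep^~ L).
Proof.
move=> a x y; rewrite /corep scaler_sumr -big_split; apply: eq_bigr => M _ /=.
by rewrite scalerA -scalerDl.
Qed.

Lemma sum_delta_mul k (f : 'I_n -> A) : \sum_m (k == m)%:R * f m = f k.
Proof.
rewrite (bigD1 k) //= eqxx mul1r big1 ?addr0 // => m; rewrite eq_sym => /negPf ->.
by rewrite mul0r.
Qed.

Lemma corep_cons y i L :
  corep y (i :: L) = \sum_m u i m * corep (ann m y) L.
Proof.
rewrite /corep sum_wordsS; apply: eq_bigr => m _; rewrite mulr_sumr.
by apply: eq_bigr => M _; rewrite /= scalerAr.
Qed.

Lemma corep_ann y k L : \sum_j u j k * corep y (j :: L) = corep (ann k y) L.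
Proof.
under eq_bigr => j _ do rewrite corep_cons mulr_sumr.
rewrite exchange_big /=.
under eq_bigr => m _ do (under eq_bigr => j _ do rewrite mulrA; rewrite -mulr_suml u_colE).
exact: sum_delta_mul.
Qed.

Lemma linear_mull (a : A) : linear (fun x : A => a * x).
Proof. by move=> c x y; rewrite mulrDr scalerAr. Qed.

(** Induction along Wenzl's recursion: the row relation inverts the induction hypothesis ([row]),
    and the column relation, through [corep_ann], moves the annihilation in the correction term past
    the coaction. *)
Lemma corep_cre y k L : \sum_j u j k * cre j (corep y) L = corep (cre k y) L.
Proof.
elim: L k y => [|m L IH] k y.
  by rewrite big1 => [|j _]; rewrite ?mulr0 // /corep big_seq1 scale0r.
have row z : \sum_l u m l * corep (cre l z) L = cre m (corep z) L.
  under eq_bigr => l _ do rewrite -IH mulr_sumr.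
  rewrite exchange_big /=.
  under eq_bigr => j _ do (under eq_bigr => l _ do rewrite mulrA; rewrite -mulr_suml u_rowE).
  exact: sum_delta_mul.
rewrite corep_cons.
have annE l : corep (ann l (cre k y)) L =
    (k == l)%:R *: corep y L - N (size L) *: corep (cre l (ann k y)) L.
  rewrite /corep !scaler_sumr -sumrB; apply: eq_sum_words => M sM.
  by rewrite /ann cre_cons sM !scalerA -scalerBl.
under [RHS]eq_bigr => l _ do rewrite annE mulrBr -!scalerAr.
rewrite sumrB -scaler_sumr row.
have -> : cre m (corep (ann k y)) L = \sum_j u j k * cre m (ann j (corep y)) L.
  rewrite (_ : corep (ann k y) = fun L' => \sum_j u j k * ann j (corep y) L').
    rewrite cre_sum; apply: eq_bigr => j _.
    exact: (cre_map _ _ _ _ (linear_mull (u j k))).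
  by apply/funext => L'; rewrite -corep_ann.
under eq_bigr => j _ do rewrite cre_cons mulrBr -!scalerAr.
rewrite sumrB -scaler_sumr; congr (_ - _).
rewrite (bigD1 m) //= eqxx scale1r big1 ?addr0 => [|j /negPf ->]; last by rewrite scale0r.
rewrite (bigD1 k) //= eqxx scale1r big1 ?addr0 // => j.
by rewrite eq_sym => /negPf ->; rewrite scale0r.
Qed.

Definition fund_word := fix fund_word I K (X : bitensor F n) : bitensor F n :=
  match I, K with
  | [::], [::] => X
  | i :: I', k :: K' => fund N i k (fund_word I' K' X)
  | _, _ => 0
  end.

Lemma cre_sum_seq (E : lmodType F) (T : Type) (r : seq T) (f : T -> word -> E) i I :
  cre i (fun J => \sum_(t <- r) f t J) I = \sum_(t <- r) cre i (f t) I.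
Proof.
elim: r => [|t r IH].
  rewrite big_nil -[RHS](cre0 N E i I); congr (cre _ _ _).
  by apply/funext => J; rewrite big_nil.
rewrite big_cons -IH -creD; congr (cre _ _ _).
by apply/funext => J; rewrite big_cons.
Qed.

(* Words in the operators [fund] intertwine the coaction of [u] on the second leg. *)
Lemma fund_word_corep (X : bitensor F n) I K :
  (forall I0 L, corep (X I0) L = X I0 L *: 1) -> size I = size K ->
  forall I0 L, \sum_(J <- words n (size I)) fund_word I J X I0 L *: mon J K =
    corep (fund_word I K X I0) L.
Proof.
move=> fixX; elim: I K => [|i I IH] [|k K] //= eIK I0 L.
  by rewrite big_seq1 fixX.
have {}IH := IH K (eq_add_S _ _ eIK).
rewrite -/(words n (size I).+1) sum_wordsS /=.
pose Z J := fund_word I J X.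
(* The sum over [J] passes through both creations by [cre_map], after which the induction hypothesis
   applies; the first leg is a spectator. *)
have creE j : \sum_(J <- words n (size I)) cre j (cre i (Z J) I0) L *: mon J K =
    cre j (corep (cre i (Z K) I0)) L.
  transitivity (cre j (fun L' => \sum_(J <- words n (size I))
      cre i (Z J) I0 L' *: mon J K) L).
    rewrite cre_sum_seq; apply: eq_bigr => J _; apply/esym.
    apply: (@cre_map _ _ _ _ _ (fun c : F^o => c *: mon J K) (cre i (Z J) I0)).
    by move=> a c d; rewrite scalerDl scalerA.
  congr (cre _ _ _); apply/funext => L'.
  transitivity (cre i (fun I' => \sum_(J <- words n (size I)) Z J I' L' *: mon J K) I0).
    rewrite cre_sum_seq; apply: eq_bigr => J _; rewrite cre_pt; apply/esym.
    apply: (@cre_map _ _ _ _ _ (fun c : F^o => c *: mon J K) (fun I' => Z J I' L')).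
    by move=> a c d; rewrite scalerDl scalerA.
  rewrite -[RHS](@cre_map _ _ _ _ _ (corep^~ L') (Z K) i I0 (linear_corep L')).
  congr (cre _ _ _).
  by apply/funext => I'; exact: IH.
transitivity (\sum_j u j k * cre j (corep (cre i (Z K) I0)) L
    + N (size I0).+1 *: \sum_j u j k * corep (Z K (i :: I0)) (j :: L)).
  rewrite scaler_sumr -big_split; apply: eq_bigr => j _ /=.
  rewrite -creE -IH mulr_sumr mulr_sumr scaler_sumr -big_split.
  apply: eq_bigr => J _ /=.
  by rewrite fundE scalerDl -!scalerAr scalerA.
rewrite corep_cre corep_ann addrC -linear_corep; congr (corep _ _).
by rewrite addrC.
Qed.

End Monomials.

(** * Equality of Haar integrals and vacuum expectations *)

Section HaarMoments.
Variables (R : realType) (n : nat).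
Local Notation C := R[i].
Local Notation word := (seq 'I_n).
Hypothesis n2 : (2 < n)%N.
Local Notation N := (wenzlC R n).
Local Notation H := (fock_hilbert R n2).
Variables (A T : cstarAlgType R) (u : 'M[A]_n).
Hypothesis hA : is_Ao u.
Variables (i1 i2 : {lrmorphism A -> T}).
Hypothesis comm12 : forall a b, i1 a * i2 b = i2 b * i1 a.
Variable Delta : {lrmorphism A -> T}.
Hypothesis DeltaE : forall i j, Delta (u i j) = \sum_(k < n) i1 (u i k) * i2 (u k j).
Variable h : {scalar A}.
Hypothesis h1 : h 1 = 1.
Variable E : {linear T -> A}.
Hypothesis E_tensor : forall a b, E (i1 a * i2 b) = h b *: a.
Hypothesis E_Delta : forall a, E (Delta a) = h a *: 1.

Implicit Types I J K : word.

Lemma Delta_mon I K : size I = size K ->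
  Delta (mon u I K) = \sum_(J <- words n (size I)) i1 (mon u I J) * i2 (mon u J K).
Proof.
elim: I K => [|i I IH] [|k K] //=; first by rewrite big_seq1 !rmorph1 mulr1.
move=> /eq_add_S eIK; rewrite [LHS]rmorphM /= DeltaE IH // -/(words n (size I).+1) sum_wordsS.
rewrite mulr_suml; apply: eq_bigr => l _; rewrite mulr_sumr.
apply: eq_bigr => J _; rewrite /= !rmorphM -!mulrA; congr (_ * _).
by rewrite !mulrA comm12.
Qed.

(** Invariance read on matrix entries; an identity in [A], so any morphism out of [A] may be applied
    to it. *)
Lemma haar_mon I K : size I = size K ->
  \sum_(J <- words n (size I)) h (mon u J K) *: mon u I J = h (mon u I K) *: 1.
Proof.
move=> eIK; rewrite -E_Delta Delta_mon // linear_sum.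
by apply: eq_bigr => J _; rewrite E_tensor.
Qed.

Definition vacuum_moment I K : C := fund_word N I K (vacuum R n) [::] [::].

Lemma acts_mon (f : {lrmorphism A -> opalg H}) I J :
  (forall i j, f (u i j) = fund_op R n2 i j) ->
  exists S : H -> H, acts (f (mon u I J)) S /\
    forall X : fock R n, fock_val (S X) = fund_word N I J X.
Proof.
move=> fu; elim: I J => [|i I IH] [|k J] /=.
- by exists id; split=> //; rewrite rmorph1; exact: acts1.
- by exists (fun=> 0); split=> //; rewrite rmorph0; exact: acts0.
- by exists (fun=> 0); split=> //; rewrite rmorph0; exact: acts0.
have [S [aS eS]] := IH J; exists (fund_fock n2 i k \o S); split=> [|X].
  by rewrite rmorphM /= fu; exact: actsM (acts_fund R n2 i k) aS.
by rewrite /= eS.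
Qed.

(** [P H = H]: the image of [haar_mon] under the universal morphism, evaluated at the vacuum. *)
Lemma vacuum_moment_col I K : size I = size K ->
  \sum_(J <- words n (size I)) h (mon u J K) * vacuum_moment I J = h (mon u I K).
Proof.
move=> eIK; have [f fs fu] := Ao_lift hA (fund_mx_orthogonal R n2).
have fuE i j : f (u i j) = fund_op R n2 i j by rewrite fu mxE.
have /choice[S aS] := fun J => acts_mon I J fuE.
have aL : acts (\sum_(J <- words n (size I)) h (mon u J K) *: f (mon u I J))
    (fun X => \sum_(J <- words n (size I)) h (mon u J K) *: S J X).
  by apply: acts_sum => J; apply: actsZ; case: (aS J).
have := congr1 f (haar_mon eIK); rewrite linear_sum linearZ /= rmorph1.
under eq_bigr => J _ do rewrite linearZ /=.
move=> fE; rewrite fE in aL.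
have := acts_vacuum (vacuum R n) aL (actsZ (h (mon u I K)) (acts1 R n2)).
have valE : {morph (fun Y : fock R n => Y [::] [::]) : Y Z / Y + Z} by [].
rewrite (big_morph _ valE (erefl ((0 : fock R n) [::] [::]))) => sumE.
transitivity (h (mon u I K) * vacuum R n [::] [::]); last by rewrite /= mulr1.
rewrite -[RHS]sumE; apply: eq_bigr => J _.
by rewrite /vacuum_moment; have [_ <-] := aS J.
Qed.

(** [P H = P]: [fund_word_corep] for the fixed vacuum, read at the empty words, then integrated by
    [h]. *)
Lemma vacuum_moment_row I K : size I = size K ->
  \sum_(J <- words n (size I)) vacuum_moment I J * h (mon u J K) = vacuum_moment I K.
Proof.
move=> eIK; have [_ u_row u_col] := Ao_relations hA.
have fixV (I0 L : word) : corep u (vacuum R n I0) L = vacuum R n I0 L *: 1.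
  rewrite /corep; case: L => [|l L]; first by rewrite big_seq1.
  rewrite [RHS](_ : _ = 0); last by rewrite /= /vacuum_fun andbF scale0r.
  apply: big1_seq => M /andP[_ /size_words].
  by case: M => // m M _; rewrite /= /vacuum_fun andbF scale0r.
have := fund_word_corep N u_row u_col fixV eIK [::] [::].
move=> /(congr1 h); rewrite linear_sum /corep big_seq1 linearZ /= h1 mulr1 => e.
by apply: etrans e; apply: eq_bigr => J _; rewrite linearZ.
Qed.

Lemma haar_vacuum_moment I K : size I = size K -> h (mon u I K) = vacuum_moment I K.
Proof.
move=> eIK; rewrite -vacuum_moment_row // -[LHS]vacuum_moment_col //.
by apply: eq_bigr => J _; rewrite mulrC.
Qed.

End HaarMoments.

(** * Moments of Rogers polynomials *)

Section RogersMoments.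
Variables (F : numFieldType) (q : F).
Hypothesis q0 : q != 0.
Hypothesis qD : forall k, 1 + q ^+ k != 0.
Hypothesis qB : forall k, 1 - q ^+ k.+1 != 0.
Implicit Types (f : nat -> F) (k m s : nat) (r t : int).

(** The Rogers recurrence has coefficients [(1 - q^(k+1)) / (1 - beta q^k)] and
    [(1 - beta^2 q^(k-1)) / (1 - beta q^k)]; at [beta = -q] both equal [tau_(k+1)]. *)
Definition tau k : F := (1 - q ^+ k) / (1 + q ^+ k).

(** If [f k = L (p Q_k)] then [step f k = L (w p Q_k)]; the value 0 stands for [Q_(-1) = 0]. *)
Definition step f : nat -> F :=
  fun k => tau k.+1 * (f k.+1 + if k is k'.+1 then f k' else 0).

(* [lam s k] is [L (U_s Q_k)], where [U_s] are the Chebyshev polynomials in [w],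
   [Q_k] the Rogers polynomials normalised by
   [w Q_k = tau_(k+1) (Q_(k+1) + Q_(k-1))], and [L Q_k = (k == 0)]. *)
Fixpoint lam_pair s : (nat -> F) * (nat -> F) :=
  if s is s'.+1 then
    let: (f, g) := lam_pair s' in (fun k => step f k - g k, f)
  else (fun k => (k == 0)%:R, fun=> 0).
Definition lam s := (lam_pair s).1.

Lemma lam1 k : lam 1 k = step (lam 0) k.
Proof. by rewrite /lam /= subr0. Qed.

Lemma lamSS s k : lam s.+2 k = step (lam s.+1) k - lam s k.
Proof. by rewrite /lam /=; case: (lam_pair s). Qed.

(* [alpha] and [beta] are the factors of Rogers' connection coefficients between the
   parameters [q] (Chebyshev polynomials) and [-q]. *)
Fixpoint alpha k : F :=
  if k is k'.+1 then alpha k' * (1 - q ^+ k) / (1 + q ^+ k.+1) else 1.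
Fixpoint beta k : F :=
  if k is k'.+1 then beta k' * (- q) * (1 + q ^+ k') / (1 - q ^+ k) else 1.

(** Each [step] moves the degree by one, starting from degree 0. Two consecutive [s] are carried
    along because the recurrence has order two. *)
Lemma lam_eq0 s m : (s < m)%N || odd (s + m) -> lam s m = 0.
Proof.
suff: forall m, ((s < m)%N || odd (s + m) -> lam s m = 0) /\
    ((s.+1 < m)%N || odd (s.+1 + m) -> lam s.+1 m = 0) by move=> /(_ m)[].
elim: s => [|s IH] {}m.
  split; first by case: m.
  rewrite lam1 /step; case: m => [|[|m]] //=; by rewrite addr0 mulr0.
split; first by case: (IH m).
move=> h; rewrite lamSS (proj1 (IH m)) ?subr0; last first.
  by move: h; rewrite /= !negbK => /orP[/ltnW/ltnW->//|->]; rewrite orbT.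
rewrite /step (proj2 (IH m.+1)) ?add0r; last first.
  move: h; rewrite !addSn addnS /= !negbK => /orP[lt|->]; rewrite ?orbT //.
  by rewrite ltnS ltnW // ltnW.
case: m h => [|m] h; first by rewrite mulr0.
rewrite (proj2 (IH m)) ?mulr0 //.
by move: h; rewrite !addSn addnS /= !negbK ltnS.
Qed.

(** Rogers' formula gives [Q_m] in [U_(m+2b)] the coefficient [alpha (m + b) * beta b * (1 +
    q^(m+1)) / (1 + q)], and [L (Q_m^2) = tau_(m+1) / tau_1]; the right side is their product. The
    proof checks it against the recurrence, by induction on [m + 2b]. *)
Lemma lam_closed m b :
  lam (m + b.*2) m = alpha (m + b) * beta b * (1 - q ^+ m.+1) / (1 - q).
Proof.
have q1 : 1 - q != 0 by have := qB 0; rewrite expr1.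
suff: forall s m b, (m + b.*2 <= s)%N ->
    lam (m + b.*2) m = alpha (m + b) * beta b * (1 - q ^+ m.+1) / (1 - q).
  by move=> /(_ (m + b.*2)%N m b (leqnn _)).
elim=> [|s IH] {}m {}b.
  by case: m b => [|m] [|b] //; rewrite /= expr1 !mul1r divff.
case: b => [|b].
  rewrite !addn0; case: m => [|m] ms; first by rewrite /= expr1 !mul1r divff.
  have -> : lam m.+1 m.+1 = step (lam m) m.+1.
    by case: m ms => [|m] _; rewrite ?lam1 // lamSS lam_eq0 ?subr0 ?leqnSn.
  have := IH m 0%N; rewrite !addn0 => eqm.
  rewrite /step lam_eq0 ?add0r ?leqnSn // eqm; last by rewrite -ltnS.
  rewrite /tau /= !exprS; have := qD m.+2; rewrite !exprS.
  by move: (q ^+ m) => y hy; field; apply/andP.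
rewrite doubleS !addnS => ms; rewrite lamSS IH; last by rewrite ltnW // -ltnS.
have e1 := IH m.+1 b; rewrite !addSn in e1; rewrite /step e1 //.
case: m ms e1 => [|m] ms e1.
  rewrite !add0n /tau /= addr0; have := qD b.+2; have := qB b; have := qD 1.
  rewrite !exprS !expr0 !mulr1; move: (q ^+ b) => x h1 h2 h3.
  by field; do ?[apply/andP; split].
have e2 := IH m b.+1; rewrite doubleS !addnS in e2.
rewrite !addSn e2; last by rewrite -ltnS.
rewrite /tau /= !exprS !exprD.
have := qD (m + b).+3; have := qD (m + b).+2; have := qB b; have := qB (m + b); have := qD m.+2.
rewrite !exprS !exprD; move: (q ^+ b) (q ^+ m) (alpha (m + b)) (beta b) => x y A B.
by move=> h1 h2 h3 h4 h5; field; do ?[apply/andP; split].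
Qed.

(* Extends [lam] by [U_(-1) = 0] and [U_(-s-2) = - U_s], so that
   [w U_t = U_(t+1) + U_(t-1)] for every integer [t]. *)
Definition lamz t k : F :=
  match t with Posz s => lam s k | Negz 0 => 0 | Negz s.+1 => - lam s k end.

Lemma step_lin (a : F) f g k : step (fun k => a * f k + g k) k = a * step f k + step g k.
Proof.
rewrite /step; case: k => [|k].
  by rewrite !addr0 mulrDr mulrCA.
by ring.
Qed.

Lemma stepN f k : step (fun k => - f k) k = - step f k.
Proof. by rewrite /step; case: k => [|k]; ring. Qed.

Lemma step_sum (I : Type) (r : seq I) (c : I -> F) (f : I -> nat -> F) k :
  step (fun k => \sum_(i <- r) c i * f i k) k = \sum_(i <- r) c i * step (f i) k.
Proof.
elim: r k => [|i r IH] k.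
  by rewrite /step !big_nil; case: k => [|k]; rewrite ?big_nil addr0 mulr0.
rewrite big_cons -IH -step_lin /step big_cons.
by case: k => [|k]; rewrite ?big_cons.
Qed.

Lemma lamz_step t k : lamz (t + 1) k + lamz (t - 1) k = step (lamz t) k.
Proof.
case: t => [[|s]|[|[|s]]].
- rewrite (_ : 0%:Z + 1 = 1%:Z) // (_ : 0%:Z - 1 = Negz 0) //= addr0; exact: lam1.
- have -> : s.+1%:Z + 1 = s.+2%:Z by lia.
  have -> : s.+1%:Z - 1 = s%:Z by lia.
  by rewrite -[LHS]/(lam s.+2 k + lam s k) lamSS subrK.
- rewrite (_ : Negz 0 + 1 = 0%:Z) // (_ : Negz 0 - 1 = Negz 1) //= subrr /step.
  by case: k => [|k]; rewrite addr0 mulr0.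
- rewrite (_ : Negz 1 + 1 = Negz 0) // (_ : Negz 1 - 1 = Negz 2) // add0r.
  by rewrite -[LHS]/(- lam 1 k) lam1; exact/esym/(stepN (lam 0)).
- have -> : Negz s.+2 + 1 = Negz s.+1 by lia.
  have -> : Negz s.+2 - 1 = Negz s.+3 by lia.
  rewrite -[LHS]/(- lam s k - lam s.+2 k) lamSS opprB addKr.
  exact/esym/(stepN (lam s.+1)).
Qed.

(** With [U_t] defined for all integers, multiplication by [w] is the sum of the two unit shifts, so
    [w^m U_0] expands binomially without boundary terms. *)
Lemma moment_expansion (mu : nat -> nat -> F) :
  (forall k, mu 0%N k = (k == 0%N)%:R) ->
  (forall m k, mu m.+1 k = step (mu m) k) ->
  forall m k, mu m k = \sum_(j < m.+1) 'C(m, j)%:R * lamz (m%:Z - j.*2%:Z) k.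
Proof.
move=> mu0 muS; elim=> [|m IH] k.
  by rewrite big_ord1 mul1r mu0.
rewrite muS; transitivity (step (fun k => \sum_(j < m.+1)
    'C(m, j)%:R * lamz (m%:Z - j.*2%:Z) k) k).
  by rewrite /step IH; case: k => [|k]; rewrite ?IH.
rewrite step_sum; under eq_bigr => j _ do rewrite -lamz_step mulrDr.
rewrite big_split /= [RHS]big_ord_recl /= bin0.
have binSE (j : 'I_m.+1) : 'C(m.+1, bump 0 j) = ('C(m, j.+1) + 'C(m, j))%N.
  by rewrite /bump /= add1n binS.
under [in RHS]eq_bigr => j _ do rewrite binSE natrD mulrDl.
rewrite big_split /= addrA; congr (_ + _); last first.
  by apply: eq_bigr => j _; congr (_ * lamz _ _); rewrite /bump /=; lia.
transitivity (\sum_(j < m.+2) 'C(m, j)%:R * lamz (m.+1%:Z - j.*2%:Z) k).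
  rewrite [RHS]big_ord_recr /= bin_small // mul0r addr0.
  by apply: eq_bigr => j _; congr (_ * lamz _ _); lia.
by rewrite big_ord_recl /= bin0.
Qed.

Lemma qDz t : 1 + q ^ t != 0.
Proof.
case: t => k; first exact: qD.
rewrite NegzE -invr_expz -exprnP.
have qk : q ^+ k.+1 != 0 by rewrite expf_neq0.
have -> : 1 + (q ^+ k.+1)^-1 = (1 + q ^+ k.+1) / q ^+ k.+1 by field.
by rewrite mulf_neq0 ?invr_eq0.
Qed.

Definition fz t : F := (1 + q ^ t)^-1.

Lemma fzN t : fz (- t) = 1 - fz t.
Proof.
have qt : q ^ t != 0 by rewrite expfz_neq0.
rewrite /fz -invr_expz; have := qDz t; move: (q ^ t) qt => x x0 x1.
by field; do ?[apply/andP; split] => //; rewrite addrC.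
Qed.

Definition lam_diag t : F := 2 * (1 + q) / (1 - q) * (-1) ^ t * (fz (t + 1) - fz t).

(** Both sides are multiplied by [- q (1 + q^r) / (1 + q^(r+2))] when [r] increases by one. *)
Lemma alpha_beta (r : nat) : alpha r * beta r =
  2 * (1 + q) / (1 - q) * (-1) ^+ r * ((1 + q ^+ r.+1)^-1 - (1 + q ^+ r)^-1).
Proof.
have q1 : 1 - q != 0 by have := qB 0; rewrite expr1.
elim: r => [|r IH].
  have := qD 0; have := qD 1; rewrite !expr0 !expr1 /= => h1 h2.
  by field; do ?[apply/andP; split].
transitivity (alpha r * beta r * (- q * (1 + q ^+ r) / (1 + q ^+ r.+2))).
  rewrite /= !exprS; have := qD r.+2; have := qB r; rewrite !exprS.
  move: (q ^+ r) (alpha r) (beta r) => x a b h1 h2.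
  by field; do ?[apply/andP; split].
rewrite IH !exprS; have := qD r.+2; have := qD r.+1; have := qD r; rewrite !exprS.
move: (q ^+ r) ((-1) ^+ r) => x a h1 h2 h3.
by field; do ?[apply/andP; split].
Qed.

Lemma lam_even (r : nat) : lam r.*2 0 = lam_diag r%:Z.
Proof.
have q1 : 1 - q != 0 by have := qB 0; rewrite expr1.
rewrite -[LHS]/(lam (0 + r.*2) 0) lam_closed expr1 mulfK // add0n alpha_beta.
by rewrite /lam_diag /fz (_ : r%:Z + 1 = r.+1%:Z) //; lia.
Qed.

Lemma sgN t : (-1 : F) ^ (- t) = (-1) ^ t.
Proof. by rewrite -exprz_inv invrN1. Qed.

Lemma lam_diagN t : lam_diag (- t) = - lam_diag (t - 1).
Proof.
rewrite /lam_diag sgN subrK (_ : - t + 1 = - (t - 1)) ?fzN; last by lia.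
have -> : (-1 : F) ^ (t - 1) = - (-1) ^ t.
  by rewrite expfzDr ?oppr_eq0 ?oner_eq0 // sgN mulrN1.
move: ((-1) ^ t) (_ / (1 - q)) (fz t) (fz (t - 1)) => a b c d; ring.
Qed.

Lemma lamz_even t : lamz (t * 2) 0 = lam_diag t.
Proof.
case: t => r.
  have -> : r%:Z * 2 = r.*2%:Z by lia.
  exact: lam_even.
rewrite NegzE lam_diagN (_ : r.+1%:Z - 1 = r%:Z); last by lia.
have -> : - r.+1%:Z * 2 = Negz r.*2.+1 by rewrite NegzE; lia.
by rewrite -[LHS]/(- lam r.*2 0) lam_even.
Qed.

Lemma lamz_odd t : odd `|t|%N -> lamz t 0 = 0.
Proof.
case: t => [s|[|s]] //= h; first by rewrite lam_eq0 // addn0 h orbT.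
rewrite lam_eq0 ?oppr0 // addn0; apply/orP; right; lia.
Qed.

Lemma natr_bin_left m k : m.+1%:R * 'C(k, m.+1)%:R = (k%:R - m%:R) * 'C(k, m)%:R :> F.
Proof.
rewrite -natrM mul_bin_left natrM; have [le|lt] := leqP m k; first by rewrite natrB.
by rewrite bin_small // !mulr0.
Qed.

Definition bin_shift k m : F := if m is m'.+2 then 'C(2 * k, m')%:R else 0.

(** Coefficient of [x^m] in [(x d/dx - (k + 1)) (1 + x)^(2k+2) = (k + 1) (x^2 - 1) (1 + x)^(2k)].
    This is the origin of the factor [r]. *)
Lemma binomial_difference k m :
  'C(2 * k + 2, m)%:R * (m%:Z - k.+1%:Z)%:~R =
  k.+1%:R * (bin_shift k m - 'C(2 * k, m)%:R) :> F.
Proof.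
rewrite rmorphB /= -!pmulrn.
case: m => [|[|m]] /=; first by rewrite !bin0; ring.
  by rewrite !bin1 natrD !natrM -natr1; ring.
rewrite addn2 !binS !natrD.
have := natr_bin_left m.+1 (2 * k); have := natr_bin_left m (2 * k).
rewrite -[m.+2%:R]natr1 -[m.+1%:R]natr1 -[k.+1%:R]natr1 natrM.
move: ('C(_, m)%:R) ('C(_, m.+1)%:R) ('C(_, m.+2)%:R) => a b c h1 h2.
apply/eqP; rewrite -subr_eq0; apply/eqP.
transitivity ((m%:R + 1 + 1) * c - (2 * k%:R - (m%:R + 1)) * b
  + ((m%:R + 1) * b - (2 * k%:R - m%:R) * a)); first by ring.
by rewrite h1 h2 !subrr addr0.
Qed.

Lemma sg_succ t : (-1 : F) ^ (t + 1) = - (-1) ^ t.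
Proof. by rewrite expfzDr ?oppr_eq0 ?oner_eq0 // expr1z mulrN1. Qed.

Lemma sg_pred t : (-1 : F) ^ (t - 1) = - (-1) ^ t.
Proof. by rewrite -[in RHS](subrK 1 t) sg_succ opprK. Qed.

(** The moment sum weights [t] and [-t] equally; symmetrising removes [fz t] and leaves a difference
    fit for summation by parts. *)
Lemma lam_diag_sym t : lam_diag t + lam_diag (- t) =
  2 * (1 + q) / (1 - q) * ((-1) ^ t * (fz (t + 1) - fz (t - 1))).
Proof.
rewrite lam_diagN /lam_diag subrK sg_pred.
by move: (_ / (1 - q)) ((-1) ^ t) (fz _) (fz _) (fz _) => a b c d e; ring.
Qed.

Lemma sum_binomial_shift k (G : int -> F) :
  \sum_(m < (2 * k.+1).+1) (bin_shift k m - 'C(2 * k, m)%:R) * G (m%:Z - k.+1%:Z) =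
  \sum_(j < (2 * k).+1) 'C(2 * k, j)%:R * (G (j%:Z - k%:Z + 1) - G (j%:Z - k%:Z - 1)).
Proof.
under eq_bigr do rewrite mulrBl; under [RHS]eq_bigr do rewrite mulrBr.
rewrite !sumrB mulnS; congr (_ - _).
  rewrite 2!big_ord_recl /= !mul0r !add0r.
  by apply: eq_bigr => j _; congr (_ * G _); rewrite /bump /=; lia.
rewrite 2!big_ord_recr /= !bin_small // !mul0r !addr0.
by apply: eq_bigr => j _; congr (_ * G _); lia.
Qed.

Section Moments.
Variable mu : nat -> nat -> F.
Hypothesis mu0 : forall k, mu 0%N k = (k == 0%N)%:R.
Hypothesis muS : forall m k, mu m.+1 k = step (mu m) k.

Lemma odd_moment k : mu (2 * k + 1) 0 = 0.
Proof.
rewrite (moment_expansion mu0 muS) big1 // => j _; rewrite lamz_odd ?mulr0 //.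
lia.
Qed.

Lemma even_moment_sum k :
  mu (2 * k) 0 = \sum_(j < (2 * k).+1) 'C(2 * k, j)%:R * lam_diag (k%:Z - j%:Z).
Proof.
rewrite (moment_expansion mu0 muS); apply: eq_bigr => j _; congr (_ * _).
rewrite -lamz_even; congr lamz; lia.
Qed.

Lemma even_moment k : mu (2 * k) 0 =
  (q + 1) / (q - 1) * (k.+1%:R)^-1 * \sum_(m < (2 * k.+1).+1)
    (-1) ^ (m%:Z - k.+1%:Z) * 'C(2 * k + 2, absz (k.+1%:Z + (m%:Z - k.+1%:Z))%R)%:R
      * ((m%:Z - k.+1%:Z)%:~R / (1 + q ^ (m%:Z - k.+1%:Z))).
Proof.
have q1 : 1 - q != 0 by have := qB 0; rewrite expr1.
have two0 : (2 : F) != 0 by exact: qD 0.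
have k0 : k.+1%:R != 0 :> F by rewrite pnatr_eq0.
pose G t := (-1) ^ t * fz t.
pose S := \sum_(j < (2 * k).+1) 'C(2 * k, j)%:R *
  ((-1) ^ (j%:Z - k%:Z) * (fz (j%:Z - k%:Z + 1) - fz (j%:Z - k%:Z - 1))).
transitivity ((1 + q) / (1 - q) * S).
  (* The doubled sum is added to its own reversal, which pairs [t] with [-t]. *)
  rewrite even_moment_sum; apply: (mulfI two0); rewrite mulr_natl mulr2n.
  rewrite {1}(reindex_inj rev_ord_inj) -big_split /= mulrA mulrA mulr_sumr.
  apply: eq_bigr => j _; rewrite subSS bin_sub -?mulrDr; last by rewrite -ltnS.
  have -> : k%:Z - (2 * k - j)%N%:Z = j%:Z - k%:Z by have := ltn_ord j; lia.
  by rewrite -(opprB j%:Z) lam_diag_sym mulrCA.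
(* The sign that turns [1 - q] into [q - 1] is the one produced by
   [(-1)^(t+1) = (-1)^(t-1) = - (-1)^t]. *)
transitivity ((q + 1) / (q - 1) * (k.+1%:R)^-1 * (k.+1%:R * - S)).
  have q1' : q - 1 != 0 by rewrite -opprB oppr_eq0.
  clearbody S; move: (k.+1%:R) k0 => c c0.
  by field; do ?[apply/andP; split].
congr (_ * _); rewrite -sumrN.
transitivity (k.+1%:R * \sum_(m < (2 * k.+1).+1)
    (bin_shift k m - 'C(2 * k, m)%:R) * G (m%:Z - k.+1%:Z)).
  rewrite sum_binomial_shift; congr (_ * _); apply: eq_bigr => j _.
  by rewrite /G sg_succ sg_pred; ring.
rewrite mulr_sumr; apply: eq_bigr => m _.
rewrite (_ : absz (k.+1%:Z + (m%:Z - k.+1%:Z))%R = m); last by lia.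
by rewrite mulrA -binomial_difference /G /fz; ring.
Qed.

End Moments.

End RogersMoments.

(** * The invariant span of the ladder vectors *)

Section LadderVectors.
Variables (F : fieldType) (n : nat) (N : nat -> F).
Notation word := (seq 'I_n).
Hypothesis N0 : N 0 = 0.
Implicit Types (i j : 'I_n) (I J : word) (k : nat) (X Y : bitensor F n).

Definition ladder i k : word -> F^o := iter k (cre N i) (fun I => (I == [::])%:R).

Fixpoint drop_coef k : F := if k is k'.+1 then 1 - N k' * drop_coef k' else 0.

Lemma ladder_support i k I : size I != k -> ladder i k I = 0.
Proof.
elim: k I => [|k IH] I; first by case: I.
case: I => [//|m I] sI; rewrite /ladder iterS.
transitivity (cre N i (fun _ : word => 0 : F^o) (m :: I)); last exact: cre0.
by apply: eq_cre => J [eJ]; apply: IH; move: sI; rewrite /= -eJ.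
Qed.

Lemma cre_scale (E : lmodType F) (a : F) (x : word -> E) i I :
  cre N i (fun J => a *: x J) I = a *: cre N i x I.
Proof.
apply: (@cre_map _ _ _ _ _ (fun c : E => a *: c) x).
by move=> b c d; rewrite scalerDr !scalerA mulrC.
Qed.

Lemma ann_ladder i k I : ann i (ladder i k.+1) I = drop_coef k.+1 * ladder i k I.
Proof.
elim: k I => [|k IH] I; rewrite /ann {1}/ladder iterS cre_cons eqxx scale1r -/(ladder i _).
  rewrite (_ : ann i (ladder i 0) = fun=> 0) ?cre0 ?scaler0 ?subr0.
    by rewrite /= N0 mul0r subr0 mul1r.
  by apply/funext => J.
rewrite (_ : ann i (ladder i k.+1) = fun I => drop_coef k.+1 *: ladder i k I); last first.
  by apply/funext => J; rewrite IH.
rewrite cre_scale -[cre N i _]/(ladder i k.+1).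
have [<-|sI] := eqVneq (size I) k.+1.
  by rewrite mulrBl mul1r -mulrA.
by rewrite ladder_support // !scaler0 subrr mulr0.
Qed.

Definition biladder i j k : bitensor F n := fun I J => ladder i k I * ladder j k J.

Lemma fund_biladder i j k I J : fund N i j (biladder i j k) I J =
  biladder i j k.+1 I J + N k * drop_coef k ^+ 2 *
    (if k is k'.+1 then biladder i j k' I J else 0).
Proof.
rewrite fundE; congr (_ + _).
  rewrite cre_swap.
  transitivity (cre N i (fun I' => ladder j k.+1 J *: ladder i k I') I).
    congr (cre _ _ _); apply/funext => I'.
    rewrite (cre_scale (ladder i k I') (ladder j k)) -[cre N j _ J]/(ladder j k.+1 J).
    by rewrite [RHS]mulrC.
  by rewrite cre_scale -[cre N i _ I]/(ladder i k.+1 I) /biladder mulrC.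
case: k => [|k]; first by rewrite /biladder mul0r scaler0 mulr0.
rewrite /biladder -[ladder i _ (i :: I)]/(ann i (ladder i k.+1) I).
rewrite -[ladder j _ (j :: J)]/(ann j (ladder j k.+1) J) !ann_ladder.
have [->|sI] := eqVneq (size I) k.
  by rewrite mulrACA -expr2; exact: mulrA.
by rewrite (ladder_support _ sI) mulr0 !mul0r scaler0 mulr0.
Qed.

Variable s : F.

Definition scaled_fund i j X : bitensor F n := fun I J => s * fund N i j X I J.

Lemma fund_lin2 i j (a b : F) X Y I J :
  fund N i j (fun I J => a * X I J + b * Y I J) I J =
  a * fund N i j X I J + b * fund N i j Y I J.
Proof.
have fund0 : fund N i j (fun _ _ => 0) I J = 0.
  by rewrite fundE scaler0 addr0 cre_swap cre0 (cre0 N (F^o) i I).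
have -> : (fun I J => a * X I J + b * Y I J) =
    fun I J => a *: X I J + (fun I J => b *: Y I J + (fun _ _ => 0 : F^o) I J) I J.
  by apply/funext => I'; apply/funext => J'; rewrite addr0.
by rewrite !fund_lin fund0 addr0.
Qed.

Lemma iter_scaled_lin i j m (a b : F) X Y I J :
  iter m (scaled_fund i j) (fun I J => a * X I J + b * Y I J) I J =
  a * iter m (scaled_fund i j) X I J + b * iter m (scaled_fund i j) Y I J.
Proof.
elim: m I J => [//|m IH] I J; rewrite !iterS {1}/scaled_fund.
have -> : iter m (scaled_fund i j) (fun I J => a * X I J + b * Y I J) =
    fun I J => a * iter m (scaled_fund i j) X I J + b * iter m (scaled_fund i j) Y I J.
  by apply/funext => I'; apply/funext => J'.
by rewrite fund_lin2 mulrDr; congr (_ + _); rewrite mulrCA.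
Qed.

End LadderVectors.

(** * Matching the Fock recurrence with the Rogers recurrence *)

Section LadderMoments.
Variables (F : numFieldType) (q : F) (n : nat) (N : nat -> F) (s : F).
Hypothesis q0 : q != 0.
Hypothesis qD : forall k, 1 + q ^+ k != 0.
Hypothesis qB : forall k, 1 - q ^+ k.+1 != 0.
Hypothesis N0 : N 0 = 0.
Hypothesis NS : forall k, N k.+1 * (n%:R - N k) = 1.
Hypothesis qn : q + q^-1 = - n%:R.
Hypothesis s2 : s ^+ 2 = n%:R + 2.
Implicit Types (i j : 'I_n) (I J : seq 'I_n) (k m : nat).

(** [[k]/[k+1]] for quantum integers in the variable [-q], for which [[2] = - (q + q^-1) = n]. *)
Lemma wenzl_closed k : N k = - q * (1 - q ^+ k ^+ 2) / (1 - q ^+ k.+1 ^+ 2).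
Proof.
have nE : n%:R = - (q + q^-1) :> F by rewrite qn opprK.
have nz l : 1 - q ^+ l.+1 ^+ 2 != 0.
  have -> : 1 - q ^+ l.+1 ^+ 2 = (1 - q ^+ l.+1) * (1 + q ^+ l.+1) by ring.
  by rewrite mulf_neq0.
elim: k => [|k IH]; first by rewrite N0 expr0 expr1n subrr mulr0 mul0r.
have := NS k; rewrite IH nE; have := nz k; have := nz k.+1.
rewrite !(exprS q); move: (q ^+ k) => x h1 h2.
have -> : - (q + q^-1) - - q * (1 - x ^+ 2) / (1 - (q * x) ^+ 2) =
    - (1 - (q * (q * x)) ^+ 2) / (q * (1 - (q * x) ^+ 2)).
  by field; apply/andP.
move=> h3; apply: (mulIf (x := - (1 - (q * (q * x)) ^+ 2) / (q * (1 - (q * x) ^+ 2)))).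
  by rewrite mulf_neq0 ?oppr_eq0 // invr_eq0 mulf_neq0.
by rewrite h3; field; do ?[apply/andP; split].
Qed.

Lemma drop_coef_closed k :
  drop_coef N k.+1 = (1 - q ^+ k.+2) / ((1 - q) * (1 + q ^+ k.+1)).
Proof.
have q1 : 1 - q != 0 by have := qB 0; rewrite expr1.
elim: k => [|k IH].
  rewrite /= N0 mul0r subr0 expr1; have := qD 1; rewrite expr1 => h.
  by field; apply/andP.
rewrite -[LHS]/(1 - N k.+1 * drop_coef N k.+1) IH wenzl_closed.
have := qD k.+2; have := qD k.+1; have := qB k.+1; rewrite !(exprS q).
move: (q ^+ k) => x h1 h2 h3; field.
do ?[apply/andP; split] => //.
have -> : 1 - (q * (q * x)) ^+ 2 = (1 - q * (q * x)) * (1 + q * (q * x)) by ring.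
by rewrite mulf_neq0.
Qed.

(** The products of opposite recurrence coefficients agree, which is all that a diagonal rescaling
    of the basis leaves unchanged. *)
Lemma ladder_norm k :
  s ^+ 2 * (N k.+1 * drop_coef N k.+1 ^+ 2) = tau q k.+1 * tau q k.+2.
Proof.
have q1 : 1 - q != 0 by have := qB 0; rewrite expr1.
have nE : n%:R = - (q + q^-1) :> F by rewrite qn opprK.
rewrite s2 nE drop_coef_closed wenzl_closed /tau.
have := qD k.+2; have := qD k.+1; have := qB k.+1; rewrite !(exprS q).
move: (q ^+ k) => x h1 h2 h3; field.
do ?[apply/andP; split] => //.
have -> : 1 - (q * (q * x)) ^+ 2 = (1 - q * (q * x)) * (1 + q * (q * x)) by ring.
by rewrite mulf_neq0.
Qed.

(** Normalised so that the raising coefficient becomes [tau_(k+1)]; [ladder_norm] then gives the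
    lowering coefficient the same value. *)
Fixpoint rogers_coef k : F :=
  if k is k'.+1 then rogers_coef k' * s / tau q k else 1.

Lemma rogers_coefS k : rogers_coef k.+1 = rogers_coef k * s / tau q k.+1.
Proof. by []. Qed.

Definition rogers i j k : bitensor F n :=
  fun I J => rogers_coef k * biladder N i j k I J.

Lemma tau_neq0 k : tau q k.+1 != 0.
Proof. by rewrite mulf_neq0 ?invr_eq0. Qed.

Lemma scaled_fund_rogers i j k : scaled_fund N s i j (rogers i j k) =
  fun I J => tau q k.+1 * rogers i j k.+1 I J +
    tau q k.+1 * (if k is k'.+1 then rogers i j k' I J else 0).
Proof.
have t0 := tau_neq0.
apply/funext => I; apply/funext => J; rewrite /scaled_fund.
have -> : rogers i j k = fun I J => rogers_coef k * biladder N i j k I J + 0 * 0.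
  by apply/funext => I'; apply/funext => J'; rewrite mul0r addr0.
rewrite (fund_lin2 N i j _ _ (biladder N i j k) (fun _ _ => 0)) mul0r addr0.
rewrite fund_biladder // mulrDr mulrDr /rogers; congr (_ + _).
  by rewrite rogers_coefS !mulrA; congr (_ * _); have := t0 k => h; field.
case: k => [|k]; first by rewrite !mulr0.
rewrite rogers_coefS; move: (biladder _ _ _ _ _ _) => X; rewrite !mulrA; congr (_ * _).
transitivity (rogers_coef k / tau q k.+1 * (s ^+ 2 * (N k.+1 * drop_coef N k.+1 ^+ 2))).
  by have := t0 k; move: (drop_coef _ _) => d h; field.
by rewrite ladder_norm; have := t0 k => h; field.
Qed.

(** Realises [L (w^m Q_k)], with [L] the vacuum coordinate. The new factor [w] acts on [Q_k] first,
    which yields [step]. *)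
Definition ladder_moment i j m k : F :=
  iter m (scaled_fund N s i j) (rogers i j k) [::] [::].

Lemma ladder_moment0 i j k : ladder_moment i j 0 k = (k == 0%N)%:R.
Proof.
rewrite /ladder_moment /rogers /biladder; case: k => [|k] /=; first by rewrite !mulr1.
by rewrite mul0r mulr0.
Qed.

Lemma ladder_momentS i j m k :
  ladder_moment i j m.+1 k = step q (ladder_moment i j m) k.
Proof.
rewrite /ladder_moment iterSr scaled_fund_rogers /step.
case: k => [|k]; last by rewrite iter_scaled_lin mulrDr.
rewrite addr0 (_ : (fun I J => _) =
  fun I J => tau q 1 * rogers i j 1 I J + 0 * rogers i j 0 I J).
  by rewrite iter_scaled_lin mul0r addr0.
by apply/funext => I; apply/funext => J; rewrite mulr0 mul0r.
Qed.

End LadderMoments.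

Lemma iter_scaled_fund_word (F : fieldType) (n : nat) (N : nat -> F) (s : F)
    (i j : 'I_n) (X : bitensor F n) (m : nat) (I J : seq 'I_n) :
  iter m (scaled_fund N s i j) X I J =
  s ^+ m * fund_word N (nseq m i) (nseq m j) X I J.
Proof.
elim: m I J => [|m IH] I J; first by rewrite mul1r.
rewrite iterS {1}/scaled_fund.
have -> : iter m (scaled_fund N s i j) X = fun I J =>
    s ^+ m * fund_word N (nseq m i) (nseq m j) X I J + 0 * 0.
  by apply/funext => I'; apply/funext => J'; rewrite mul0r addr0 IH.
rewrite (fund_lin2 N i j _ _ (fund_word N (nseq m i) (nseq m j) X) (fun _ _ => 0)).
by rewrite mul0r addr0 mulrA -exprS.
Qed.

Lemma mon_nseq (F : fieldType) (n : nat) (A : algType F) (u : 'M[A]_n)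
    (i j : 'I_n) (m : nat) : mon u (nseq m i) (nseq m j) = u i j ^+ m.
Proof. by elim: m => [//|m IH] /=; rewrite IH -exprS. Qed.

Theorem theorem5p2 (R : realType) (n : nat) (hn : (2 < n)%N)
    (A : cstarAlgType R) (u : 'M[A]_n) (hA : is_Ao u)
    (T : cstarAlgType R) (i1 i2 : {lrmorphism A -> T})
    (hT : is_min_tensor i1 i2)
    (Delta : {lrmorphism A -> T}) (hDelta : is_comultiplication i1 i2 u Delta)
    (h : {scalar A}) (hh : is_Haar i1 i2 Delta h)
    (i j : 'I_n) (q : R) (hq : -1 < q < 0) (hqn : q + q^-1 = - n%:R) :
  let w : A := (Num.sqrt (n%:R + 2 : R))%:C *: u i j in
  (forall k : nat,
     h (w ^+ (2 * k)) =
     ((q + 1) / (q - 1) * (k.+1%:R)^-1 *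
      sum_symmetric k.+1 (fun r : int =>
        (-1) ^ r * 'C(2 * k + 2, absz (k.+1%:Z + r)%R)%:R *
        (r%:~R / (1 + q ^ r))))%:C) /\
  (forall k : nat, h (w ^+ (2 * k + 1)) = 0).
Proof.
(* The computation runs in [R[i]] with the image [Q] of [q]; the real formula is carried over at the
   end by the embedding of [R]. *)
set s := Num.sqrt _; move=> w; set Q : R[i] := q%:C.
have /andP[q1 q0] := hq.
have qk k : `|q ^+ k.+1| < 1.
  by rewrite normrX exprn_ilt1 // ltr0_norm // ltrNl.
have rcE (x : R) : x != 0 -> x%:C != 0.
  by rewrite -(inj_eq (@complexI R)).
have Q0 : Q != 0 by rewrite rcE ?lt_eqF.
have QD k : 1 + Q ^+ k != 0.
  rewrite -rmorphXn -(rmorph1 (real_complex R)) -rmorphD rcE // gt_eqF //.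
  case: k => [|k]; first by rewrite expr0; lra.
  by have := qk k; rewrite ltr_norml => /andP[]; lra.
have QB k : 1 - Q ^+ k.+1 != 0.
  rewrite -rmorphXn -(rmorph1 (real_complex R)) -rmorphB rcE // gt_eqF //.
  by have := qk k; rewrite ltr_norml => /andP[]; lra.
have Qn : Q + Q^-1 = - n%:R.
  by rewrite -fmorphV -rmorphD hqn rmorphN rmorph_nat.
have s2 : (s%:C) ^+ 2 = n%:R + 2 :> R[i].
  rewrite -rmorphXn sqr_sqrtr ?addr_ge0 ?ler0n //.
  by rewrite rmorphD rmorph_nat (rmorph_nat _ 2).
have [[tens _] [_ DeltaE]] := (hT, hDelta).
have [[_ h1] [E [_ E_tensor] E_Delta] _] := hh.
pose mu := ladder_moment Q (wenzlC R n) s%:C i j.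
(* Powers of [u i j] are the monomials of constant words, and [Q_0] is the vacuum. *)
have momentE m : h (w ^+ m) = mu m 0%N.
  rewrite /w exprZn linearZ /= -mon_nseq.
  rewrite (haar_vacuum_moment hn hA (tensor_comm tens) DeltaE h1 E_tensor E_Delta).
    rewrite /mu /ladder_moment iter_scaled_fund_word /vacuum_moment.
    congr (_ * fund_word _ _ _ _ _ _); apply/funext => I; apply/funext => J.
    by rewrite /rogers /biladder /= mul1r -natrM mulnb.
  by rewrite !size_nseq.
have mu0 := ladder_moment0 Q (wenzlC R n) s%:C i j.
have muS := ladder_momentS Q0 QD QB (wenzlC0 R n) (wenzlCS R hn) Qn s2 i j.
split=> k; rewrite momentE; last exact: odd_moment mu0 muS k.
rewrite /mu (even_moment Q0 QD QB mu0 muS) /sum_symmetric.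
rewrite !rmorphM rmorph_sum /= !fmorphV rmorphD rmorphB !rmorph1 rmorph_nat.
congr (_ * _); apply: eq_bigr => m _.
move: (m%:Z - k.+1%:Z) => t; rewrite [in RHS]rmorphM [in RHS]rmorphM /=.
rewrite fmorphXz rmorphN1 rmorph_nat; congr (_ * _).
by rewrite rmorphM /= fmorphV rmorphD /= fmorphXz rmorph1 rmorph_int.
Qed.
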